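(* Let $\Sigma$ be a ranked alphabet and $k\ge1$. A tree language $L\subseteq T_\Sigma$ is accepted by some deterministic $k$-head tree-walking automaton with nested pebbles if and only if $L=\{t\in T_\Sigma\mid t\models\phi\}$ for some closed formula $\phi$ of FO+DTC$^k$ over $\Sigma$. That is, $\mathrm{DPTWA}^k=\mathrm{FO{+}DTC}^k$.
   Context: Trees: a ranked alphabet is a finite set $\Sigma$ with a map $\mathrm{rank}:\Sigma\to\mathbb{N}$; $T_\Sigma$ is the set of trees over $\Sigma$, where a node labelled $\sigma$ has exactly $\mathrm{rank}(\sigma)$ children numbered $1,\dots,\mathrm{rank}(\sigma)$ (child number of the root is $0$). Strings are the special case of monadic trees. Logic: first-order logic over $\Sigma$ has node variables, atomic formulas $\mathrm{lab}_\sigma(x)$, $\mathrm{edg}_i(x,y)$ ($y$ is the $i$-th child of $x$), $x\le y$ ($x$ is an ancestor of $y$), $x=y$, and is closed under $\neg,\wedge,\vee,\exists,\forall$. $k$-ary transitive closure: for a formula $\phi$ with $k$-tuples $\bar x,\bar y$ of distinct free variables (other free variables fixed), $t\models\phi^*(\bar u,\bar v)$ iff there are $k$-tuples of nodes $\bar u_0=\bar u,\dots,\bar u_n=\bar v$ ($n\ge0$) with $t\models\phi(\bar u_i,\bar u_{i+1})$ for all $i<n$. It is deterministic if $\phi$ is functional: for every tree, every valuation of the other free variables and every $\bar u$ there is at most one $\bar v$ with $\phi(\bar u,\bar v)$. FO+DTC$^k$ is first-order logic extended with $k$-ary deterministic transitive closure. Automata: a $k$-head tree-walking automaton with nested pebbles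 is $\mathcal A=(Q,\Sigma,X,q_0,A,I)$: finite states $Q$, finite pebble set $X$, initial state $q_0$, accepting states $A$, finite set $I$ of instructions $\langle p,\chi,q\rangle$ with $\chi$ one of $\mathrm{up}_i$, $\mathrm{down}_{i,j}$, $\mathrm{drop}_i(x)$, $\mathrm{retrieve}(x)$, $\mathrm{lab}_{i,\sigma}$, $\mathrm{peb}_i(x)$, $\mathrm{chno}_{i,j}$ or a negated test $\neg\mathrm{lab}_{i,\sigma}$, $\neg\mathrm{peb}_i(x)$, $\neg\mathrm{chno}_{i,j}$ ($1\le i\le k$ a head, $x\in X$). Configurations: $[p,\bar u,\alpha]$ with state, $k$-tuple of head nodes, and stack $\alpha$ of (pebble,node) pairs. Semantics: $\mathrm{up}_i$/$\mathrm{down}_{i,j}$ move head $i$ to the parent/$j$-th child; $\mathrm{drop}_i(x)$ pushes $(x,u[i])$ if $x$ is not on the stack; $\mathrm{retrieve}(x)$ pops the top pair if its pebble is $x$, regardless of head positions; tests check the label of $u[i]$, the presence of $(x,u[i])$ on the stack, or the child number of $u[i]$ (negated tests succeed iff the test fails) and change nothing. A configuration is halting if no instruction applies. $t\in L(\mathcal A)$ iff from $[q_0,\overline{\mathrm{root}},\varepsilon]$ a halting configuration $[p,\overline{\mathrm{root}},\varepsilon]$ with $p\in A$ is reachable. $\mathcal A$ is deterministic if for any two distinct instructions from the same state, with tests/operations $\chi_1,\chi_2$, $\chi_1=\neg\chi_2$ or $\chi_2=\neg\chi_1$. *)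

(* Defs.v *)
From HB Require Import structures.
From mathcomp Require Import all_boot.
From Stdlib Require Import Relation_Operators.

Set Implicit Arguments.
Unset Strict Implicit.
Unset Printing Implicit Defensive.

Inductive tree (Sigma : finType) (rank : Sigma -> nat) : Type :=
  Node (s : Sigma) of {ffun 'I_(rank s) -> tree rank}.

(* A node is identified by its Dewey address: the root is [::], and the i-th
   child of u, with i counted from 1, is rcons u i. *)
Definition addr := seq nat.

Fixpoint nodes (Sigma : finType) (rank : Sigma -> nat) (t : tree rank) : seq addr :=
  match t with
  | Node s c =>
      [::] :: flatten [seq [seq i.+1 :: u | u <- nodes (c i)]
                      | i : 'I_(rank s) <- enum 'I_(rank s)]
  end.

Fixpoint label_at (Sigma : finType) (rank : Sigma -> nat) (t : tree rank) (u : addr)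
    : option Sigma :=
  match t with
  | Node s c =>
      match u with
      | [::] => Some s
      | 0 :: _ => None
      | j.+1 :: u' => if insub j is Some i then label_at (c i) u' else None
      end
  end.

Definition node (Sigma : finType) (rank : Sigma -> nat) (t : tree rank) : finType :=
  seq_sub (nodes t).

Lemma root_in_nodes (Sigma : finType) (rank : Sigma -> nat) (t : tree rank) :
  [::] \in nodes t.
Proof. by case: t. Qed.

Definition root (Sigma : finType) (rank : Sigma -> nat) (t : tree rank) : node t :=
  SeqSub (root_in_nodes t).

Definition has_label (Sigma : finType) (rank : Sigma -> nat) (t : tree rank)
    (s : Sigma) (u : node t) : bool :=
  label_at t (val u) == Some s.

Definition is_child (Sigma : finType) (rank : Sigma -> nat) (t : tree rank)
    (i : nat) (u v : node t) : bool :=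
  val v == rcons (val u) i.

Definition is_ancestor (Sigma : finType) (rank : Sigma -> nat) (t : tree rank)
    (u v : node t) : bool :=
  prefix (val u) (val v).

Definition child_number (Sigma : finType) (rank : Sigma -> nat) (t : tree rank)
    (u : node t) : nat :=
  last 0 (val u).

(* Variables are natural numbers.  FTC xs ys phi us vs is phi*(us, vs), where
   the closure is taken with respect to the variables xs, ys of phi; it binds
   xs and ys in phi, but not in us and vs. *)
Inductive formula (Sigma : finType) (k : nat) : Type :=
| FLab (s : Sigma) (x : nat)
| FEdg (i : nat) (x y : nat)
| FLe (x y : nat)
| FEq (x y : nat)
| FNot (phi : formula Sigma k)
| FAnd (phi psi : formula Sigma k)
| FOr (phi psi : formula Sigma k)
| FEx (x : nat) (phi : formula Sigma k)
| FAll (x : nat) (phi : formula Sigma k)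
| FTC (xs ys : k.-tuple nat) (phi : formula Sigma k) (us vs : k.-tuple nat).

Definition valuation (Sigma : finType) (rank : Sigma -> nat) (t : tree rank) : Type :=
  nat -> node t.

Definition assign (Sigma : finType) (rank : Sigma -> nat) (t : tree rank) (k : nat)
    (v : valuation t) (xs : k.-tuple nat) (a : k.-tuple (node t))
    : valuation t :=
  fun z => if z \in (xs : seq nat) then nth (v z) a (index z xs) else v z.

Fixpoint sat (Sigma : finType) (rank : Sigma -> nat) (t : tree rank) (k : nat)
    (v : valuation t) (phi : formula Sigma k) {struct phi} : bool :=
  match phi with
  | FLab s x => has_label s (v x)
  | FEdg i x y => is_child i (v x) (v y)
  | FLe x y => is_ancestor (v x) (v y)
  | FEq x y => v x == v y
  | FNot phi => ~~ sat v phi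
  | FAnd phi psi => sat v phi && sat v psi
  | FOr phi psi => sat v phi || sat v psi
  | FEx x phi => [exists u : node t, sat [eta v with x |-> u] phi]
  | FAll x phi => [forall u : node t, sat [eta v with x |-> u] phi]
  | FTC xs ys phi us vs =>
      connect (fun a b : k.-tuple (node t) =>
                 sat (assign (assign v xs a) ys b) phi)
              (map_tuple v us) (map_tuple v vs)
  end.

(* The values of v on xs and ys are overridden, so v only matters on the other
   free variables of phi. *)
Definition functional (Sigma : finType) (rank : Sigma -> nat) (k : nat)
    (xs ys : k.-tuple nat) (phi : formula Sigma k) : Prop :=
  forall (t : tree rank) (v : valuation t) (a b b' : k.-tuple (node t)),
    sat (assign (assign v xs a) ys b) phi ->
    sat (assign (assign v xs a) ys b') phi ->
    b = b'.

Fixpoint is_FO_DTC (Sigma : finType) (rank : Sigma -> nat) (k : nat)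
    (phi : formula Sigma k) : Prop :=
  match phi with
  | FLab _ _ | FEdg _ _ _ | FLe _ _ | FEq _ _ => True
  | FNot phi | FEx _ phi | FAll _ phi => is_FO_DTC rank phi
  | FAnd phi psi | FOr phi psi => is_FO_DTC rank phi /\ is_FO_DTC rank psi
  | FTC xs ys phi _ _ =>
      [/\ uniq (xs ++ ys), functional rank xs ys phi & is_FO_DTC rank phi]
  end.

Fixpoint free_vars (Sigma : finType) (k : nat) (phi : formula Sigma k) : seq nat :=
  match phi with
  | FLab _ x => [:: x]
  | FEdg _ x y | FLe x y | FEq x y => [:: x; y]
  | FNot phi => free_vars phi
  | FAnd phi psi | FOr phi psi => free_vars phi ++ free_vars psi
  | FEx x phi | FAll x phi => [seq z <- free_vars phi | z != x]
  | FTC xs ys phi us vs =>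
      [seq z <- free_vars phi | z \notin xs ++ ys] ++ us ++ vs
  end.

Definition closed_formula (Sigma : finType) (k : nat) (phi : formula Sigma k) : Prop :=
  free_vars phi = [::].

(* Meant for closed formulas, for which the choice of valuation is
   irrelevant. *)
Definition models (Sigma : finType) (rank : Sigma -> nat) (k : nat) (t : tree rank)
    (phi : formula Sigma k) : Prop :=
  sat (fun=> root t) phi.

Inductive test (Sigma : finType) (k : nat) (X : finType) : Type :=
| TLab (i : 'I_k) (s : Sigma)
| TPeb (i : 'I_k) (x : X)
| TChno (i : 'I_k) (j : nat).

Inductive op (Sigma : finType) (k : nat) (X : finType) : Type :=
| Up (i : 'I_k)
| Down (i : 'I_k) (j : nat)
| Drop (i : 'I_k) (x : X)
| Retrieve (x : X)
| Pos (tau : test Sigma k X)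
| Neg (tau : test Sigma k X).

Arguments Up {Sigma k X}.
Arguments Down {Sigma k X}.
Arguments Drop {Sigma k X}.
Arguments Retrieve {Sigma k X}.

Definition test_code (Sigma : finType) (k : nat) (X : finType) (tau : test Sigma k X)
    : ('I_k * Sigma) + ('I_k * X) + ('I_k * nat) :=
  match tau with
  | TLab i s => inl (inl (i, s))
  | TPeb i x => inl (inr (i, x))
  | TChno i j => inr (i, j)
  end.

Definition test_decode (Sigma : finType) (k : nat) (X : finType)
    (c : ('I_k * Sigma) + ('I_k * X) + ('I_k * nat)) : test Sigma k X :=
  match c with
  | inl (inl (i, s)) => TLab X i s
  | inl (inr (i, x)) => TPeb Sigma i x
  | inr (i, j) => TChno Sigma X i j
  end.

Lemma test_codeK (Sigma : finType) (k : nat) (X : finType) :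
  cancel (@test_code Sigma k X) (@test_decode Sigma k X).
Proof. by case. Qed.

HB.instance Definition _ (Sigma : finType) (k : nat) (X : finType) :=
  Countable.copy (test Sigma k X) (can_type (@test_codeK Sigma k X)).

Definition op_code (Sigma : finType) (k : nat) (X : finType) (chi : op Sigma k X)
    : 'I_k + ('I_k * nat) + ('I_k * X) + X + (bool * test Sigma k X) :=
  match chi with
  | Up i => inl (inl (inl (inl i)))
  | Down i j => inl (inl (inl (inr (i, j))))
  | Drop i x => inl (inl (inr (i, x)))
  | Retrieve x => inl (inr x)
  | Pos tau => inr (true, tau)
  | Neg tau => inr (false, tau)
  end.

Definition op_decode (Sigma : finType) (k : nat) (X : finType)
    (c : 'I_k + ('I_k * nat) + ('I_k * X) + X + (bool * test Sigma k X))
    : op Sigma k X :=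
  match c with
  | inl (inl (inl (inl i))) => Up i
  | inl (inl (inl (inr (i, j)))) => Down i j
  | inl (inl (inr (i, x))) => Drop i x
  | inl (inr x) => Retrieve x
  | inr (b, tau) => if b then Pos tau else Neg tau
  end.

Lemma op_codeK (Sigma : finType) (k : nat) (X : finType) :
  cancel (@op_code Sigma k X) (@op_decode Sigma k X).
Proof. by case. Qed.

HB.instance Definition _ (Sigma : finType) (k : nat) (X : finType) :=
  Countable.copy (op Sigma k X) (can_type (@op_codeK Sigma k X)).

(* The finite set of instructions is given by a list enumerating it. *)
Record ptwa (Sigma : finType) (k : nat) : Type := PTWA {
  state : finType;
  pebble : finType;
  init : state;
  accepting : {set state};
  instructions : seq (state * op Sigma k pebble * state)
}.

Definition heads (Sigma : finType) (rank : Sigma -> nat) (k : nat) (t : tree rank)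
    : Type :=
  k.-tuple (node t).

Definition move_head (Sigma : finType) (rank : Sigma -> nat) (k : nat) (t : tree rank)
    (u : heads k t) (i : 'I_k) (w : node t) : heads k t :=
  [tuple if j == i then w else tnth u j | j < k].

(* The top of the stack is the head of the list. *)
Definition stack (Sigma : finType) (rank : Sigma -> nat) (X : finType) (t : tree rank)
    : Type :=
  seq (X * node t).

Definition test_holds (Sigma : finType) (rank : Sigma -> nat) (k : nat) (X : finType)
    (t : tree rank) (tau : test Sigma k X) (u : heads k t) (alpha : stack X t)
    : bool :=
  match tau with
  | TLab i s => has_label s (tnth u i)
  | TPeb i x => (x, tnth u i) \in alpha
  | TChno i j => child_number (tnth u i) == j
  end.

Inductive exec (Sigma : finType) (rank : Sigma -> nat) (k : nat) (X : finType)
    (t : tree rank)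
    : op Sigma k X -> heads k t * stack X t -> heads k t * stack X t -> Prop :=
| ExecUp i j w u alpha :
    is_child j w (tnth u i) ->
    exec (Up i) (u, alpha) (move_head u i w, alpha)
| ExecDown i j w u alpha :
    is_child j (tnth u i) w ->
    exec (Down i j) (u, alpha) (move_head u i w, alpha)
| ExecDrop i x u alpha :
    x \notin [seq pn.1 | pn <- alpha] ->
    exec (Drop i x) (u, alpha) (u, (x, tnth u i) :: alpha)
| ExecRetrieve x w u alpha :
    exec (Retrieve x) (u, (x, w) :: alpha) (u, alpha)
| ExecPos tau u alpha :
    test_holds tau u alpha ->
    exec (Pos tau) (u, alpha) (u, alpha)
| ExecNeg tau u alpha :
    ~~ test_holds tau u alpha ->
    exec (Neg tau) (u, alpha) (u, alpha).

Definition config (Sigma : finType) (rank : Sigma -> nat) (k : nat) (A : ptwa Sigma k)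
    (t : tree rank) : Type :=
  (state A * (heads k t * stack (pebble A) t))%type.

Definition step (Sigma : finType) (rank : Sigma -> nat) (k : nat) (A : ptwa Sigma k)
    (t : tree rank) (c d : config A t) : Prop :=
  exists2 chi, (c.1, chi, d.1) \in instructions A & exec chi c.2 d.2.

Definition halting (Sigma : finType) (rank : Sigma -> nat) (k : nat) (A : ptwa Sigma k)
    (t : tree rank) (c : config A t) : Prop :=
  forall d : config A t, ~ step c d.

Definition root_config (Sigma : finType) (rank : Sigma -> nat) (k : nat) (A : ptwa Sigma k)
    (t : tree rank) (p : state A) : config A t :=
  (p, (nseq_tuple k (root t), [::])).

Definition accepts (Sigma : finType) (rank : Sigma -> nat) (k : nat) (A : ptwa Sigma k)
    (t : tree rank) : Prop :=
  exists p : state A,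
    [/\ p \in accepting A,
        clos_refl_trans _ (@step Sigma rank k A t)
          (root_config t (init A)) (root_config t p)
      & halting (root_config t p)].

Definition deterministic (Sigma : finType) (k : nat) (A : ptwa Sigma k) : Prop :=
  forall (p q1 q2 : state A) (chi1 chi2 : op Sigma k (pebble A)),
    (p, chi1, q1) \in instructions A ->
    (p, chi2, q2) \in instructions A ->
    (p, chi1, q1) != (p, chi2, q2) ->
    exists tau, (chi1 = Pos tau /\ chi2 = Neg tau)
             \/ (chi1 = Neg tau /\ chi2 = Pos tau).

(* Main.v *)
(* Both inclusions are closure properties of a class of queries under first-order
   operations and transitive closure of functional relations on k-tuples.

   From automata to formulas: with a fixed stack, the moves of A between two
   returns to that stack form a functional relation on pairs (state, k-tuple);
   it is definable by induction on the number of pebbles that may still be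
   dropped, the stacked pebbles being free variables. States are removed from
   its transitive closure as in Kleene's theorem: by determinism, the first
   return to a state r through states other than r is functional.

   From formulas to automata: a subformula is decided with its free variables
   marked by pebbles. For phi*(u, v) with phi functional, the k-tuples that
   reach v form a finite tree whose parent map is phi (restricted to arguments
   other than v). An Euler tour of this tree, siblings being ordered
   lexicographically, always terminates and meets u if and only if phi*(u, v)
   holds. To move its pebbled tuple, the automaton pebbles the new tuple on top,
   sends the k heads there, retrieves all these pebbles and drops k pebbles under
   the heads. *)

Require Import Defs.
From HB Require Import structures.
From mathcomp Require Import all_boot.
From Stdlib Require Import Relation_Operators Operators_Properties FunctionalExtensionality.
(* fingraph also exports a constant named root. *)
Import Defs.

Set Implicit Arguments.
Unset Strict Implicit.
Unset Printing Implicit Defensive.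

(** * Nodes of trees *)

Section Nodes.
Variables (Sigma : finType) (rank : Sigma -> nat).
Implicit Type t : tree rank.

Lemma mem_nodes t a : (a \in nodes t) = isSome (label_at t a).
Proof.
elim: a t => [|j a IH] [s c] //=.
rewrite inE /=; case: j => [|j].
  apply/negbTE/negP => /flattenP[_ /mapP[i _ ->]].
  by case/mapP.
case: insubP => [i _ vi|]; last first.
  move=> nlt; apply/negbTE/negP => /flattenP[_ /mapP[i _ ->]] /mapP[b _ [ji _]].
  by rewrite ji ltn_ord in nlt.
rewrite -IH; apply/idP/idP.
  case/flattenP => _ /mapP[i' _ ->] /mapP[b bi' [ji ->]].
  by have -> : i = i' by apply: val_inj; rewrite vi.
move=> ai; apply/flattenP; exists [seq i.+1 :: u | u <- nodes (c i)].
  by apply/mapP; exists i => //; rewrite mem_enum.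
by rewrite -vi; apply: map_f.
Qed.

Lemma label_at_rcons t a j :
  isSome (label_at t (rcons a j)) =
  (if label_at t a is Some s then 0 < j <= rank s else false).
Proof.
elim: a t => [|i a IH] [s c] /=.
  case: j => [|j] //=; case: insubP => [i -> _|/negbTE -> //].
  by case: (c i).
by case: i => [|i] //; case: insubP.
Qed.

Lemma ex_label t (u : node t) : exists s, has_label s u.
Proof.
have := ssvalP u; rewrite mem_nodes /has_label /=.
by case: (label_at t _) => // s _; exists s; rewrite eqxx.
Qed.

Lemma ex_child t (u : node t) s j :
  has_label s u -> 0 < j <= rank s -> exists w : node t, is_child j u w.
Proof.
move=> /eqP us js; have rj : rcons (val u) j \in nodes t.
  by rewrite mem_nodes label_at_rcons us.
by exists (SeqSub rj); rewrite /is_child.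
Qed.

Lemma child_rank t (u w : node t) s j :
  has_label s u -> is_child j u w -> 0 < j <= rank s.
Proof.
move=> /eqP us /eqP uw; have := ssvalP w.
by rewrite mem_nodes -[ssval w]/(val w) uw label_at_rcons us.
Qed.

Lemma is_child_num t (u w : node t) j : is_child j u w -> child_number w = j.
Proof. by rewrite /child_number => /eqP ->; rewrite last_rcons. Qed.

Lemma is_child_gt0 t (u w : node t) j : is_child j u w -> 0 < j.
Proof.
move=> uw; have [s us] := ex_label u.
by case/andP: (child_rank us uw).
Qed.

Definition max_rank := \max_(s : Sigma) rank s.

Lemma is_child_max t (u w : node t) j : is_child j u w -> j <= max_rank.
Proof.
move=> uw; have [s us] := ex_label u.
case/andP: (child_rank us uw) => _ /leq_trans-> //.
exact: (leq_bigmax s).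
Qed.

Lemma is_child_fun t (u w w' : node t) j :
  is_child j u w -> is_child j u w' -> w = w'.
Proof. by move=> /eqP uw /eqP uw'; apply: val_inj; rewrite uw. Qed.

Lemma is_child_inj t (u u' w : node t) i j :
  is_child i u w -> is_child j u' w -> u = u'.
Proof.
by move=> /eqP uw /eqP; rewrite uw => /rcons_inj[uu _]; apply: val_inj.
Qed.

Lemma ex_parent t (w : node t) :
  w != root t -> exists u : node t, is_child (child_number w) u w.
Proof.
case: w => a an; rewrite -val_eqE /=.
case/lastP: a an => // a j an _; have anj := an.
rewrite mem_nodes label_at_rcons in anj.
have ant : a \in nodes t by rewrite mem_nodes; case: label_at anj.
by exists (SeqSub ant); rewrite /is_child /child_number /= last_rcons.
Qed.

Lemma child_number_eq0 t (u : node t) : (child_number u == 0) = (u == root t).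
Proof.
have [->|/ex_parent[w /is_child_gt0]] := eqVneq u (root t).
  by [].
by rewrite lt0n => /negbTE.
Qed.

Lemma child_not_root t (u w : node t) j : is_child j u w -> w != root t.
Proof.
by move=> /eqP uw; rewrite -val_eqE uw /=; case: (val u).
Qed.

Lemma root_ancestor t (u : node t) : [forall w, is_ancestor u w] = (u == root t).
Proof.
apply/forallP/eqP => [/(_ (root t))|-> w]; last exact: prefix0s.
by rewrite /is_ancestor prefixs0 => /eqP u0; apply: val_inj.
Qed.

Lemma node_ind t (P : node t -> Prop) :
  P (root t) -> (forall u w j, is_child j u w -> P u -> P w) -> forall u, P u.
Proof.
move=> P0 PS u; have [n] := ubnP (size (val u)).
elim: n u => // n IH u; rewrite ltnS => un.
have [->//|/ex_parent[w wu]] := eqVneq u (root t).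
apply: (PS _ _ _ wu); apply: IH.
by move: un; rewrite (eqP wu) size_rcons.
Qed.

End Nodes.

(** * Queries and classes closed under first-order operations *)

Section Classes.
Variables (Sigma : finType) (rank : Sigma -> nat) (k : nat).

(* V plays the role of a set of free variables. *)
Definition query (V : Type) := forall t : tree rank, (V -> node t) -> bool.

Definition tup (t : tree rank) V (e : V -> node t) (f : 'I_k -> V) :
  k.-tuple (node t) := [tuple e (f i) | i < k].

Definition brel (V : Type) :=
  forall t : tree rank, (V -> node t) -> rel (k.-tuple (node t)).

Definition rel_query V (R : brel V) : query (V + 'I_k + 'I_k) :=
  fun t e => R t (fun z => e (inl (inl z)))
                 (tup e (fun i => inl (inr i))) (tup e inr).

Definition functional_brel V (R : brel V) :=
  forall t e a b b', R t e a b -> R t e a b' -> b = b'.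

Record fo_class (D : forall V, query V -> Prop) : Prop := FoClass {
  fo_sub : forall V W (g : V -> W) P,
    D V P -> D W (fun t e => P t (fun z => e (g z)));
  fo_ext : forall V (P P' : query V),
    (forall t e, P t e = P' t e) -> D V P -> D V P';
  fo_not : forall V P, D V P -> D V (fun t e => ~~ P t e);
  fo_and : forall V P P', D V P -> D V P' -> D V (fun t e => P t e && P' t e);
  fo_ex : forall V (Q : forall t, (V -> node t) -> node t -> bool),
    D (option V) (fun t e => Q t (fun z => e (Some z)) (e None)) ->
    D V (fun t e => [exists u, Q t e u]);
  fo_lab : forall V s (x : V), D V (fun t e => has_label s (e x));
  fo_edg : forall V i (x y : V), D V (fun t e => is_child i (e x) (e y));
  fo_le : forall V (x y : V), D V (fun t e => is_ancestor (e x) (e y));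
  fo_eq : forall V (x y : V), D V (fun t e => e x == e y)
}.

Definition dtc_closed (D : forall V, query V -> Prop) :=
  forall V (R : brel V), functional_brel R ->
    D _ (rel_query R) -> D _ (rel_query (fun t e => connect (R t e))).

Section Derived.
Variables (D : forall V, query V -> Prop) (DC : fo_class D).

Lemma tnth_tup (t : tree rank) V (e : V -> node t) f i : tnth (tup e f) i = e (f i).
Proof. exact: tnth_mktuple. Qed.

Lemma tup_tnth (t : tree rank) V (e : V -> node t) (f : 'I_k -> V)
    (a : k.-tuple (node t)) : (forall i, e (f i) = tnth a i) -> tup e f = a.
Proof. by move=> h; apply: eq_from_tnth => i; rewrite tnth_tup h. Qed.

Lemma fo_true V : D (fun (t : tree rank) (e : V -> node t) => true).
Proof.
apply: (fo_ext DC) (fo_ex DC (Q := fun t e u => u == u) (fo_eq DC _ _)).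
by move=> t e; apply/existsP; exists (root t).
Qed.

Lemma fo_false V : D (fun (t : tree rank) (e : V -> node t) => false).
Proof. exact: (fo_ext DC) (fo_not DC (fo_true V)). Qed.

Lemma fo_const V b : D (fun (t : tree rank) (e : V -> node t) => b).
Proof. by case: b; [exact: fo_true|exact: fo_false]. Qed.

Lemma fo_or V (P P' : query V) : D P -> D P' -> D (fun t e => P t e || P' t e).
Proof.
move=> HP HP'.
apply: (fo_ext DC) (fo_not DC (fo_and DC (fo_not DC HP) (fo_not DC HP'))).
by move=> t e; rewrite negb_and !negbK.
Qed.

Lemma fo_all V (Q : forall t, (V -> node t) -> node t -> bool) :
  D (fun t (e : option V -> node t) => Q t (fun z => e (Some z)) (e None)) ->
  D (fun t (e : V -> node t) => [forall u, Q t e u]).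
Proof.
move=> HQ; apply: (fo_ext DC) (fo_not DC (fo_ex DC (Q := fun t e u => ~~ Q t e u) _)).
  by move=> t e; rewrite negb_exists; apply: eq_forallb => u; rewrite negbK.
exact: (fo_not DC).
Qed.

Lemma fo_has V (I : Type) (s : seq I) (P : I -> query V) :
  (forall i, D (P i)) -> D (fun t e => has (fun i => P i t e) s).
Proof.
move=> HP; elim: s => [|i s IH] /=; first exact: fo_false.
exact: fo_or.
Qed.

Lemma fo_exI V (I : finType) (P : I -> query V) :
  (forall i, D (P i)) -> D (fun t e => [exists i, P i t e]).
Proof.
move=> HP; apply: (fo_ext DC) (fo_has (enum I) HP) => t e.
apply/hasP/existsP => [[i _ Pi]|[i Pi]]; exists i => //.
by rewrite mem_enum.
Qed.

Lemma fo_allI V (I : finType) (P : I -> query V) :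
  (forall i, D (P i)) -> D (fun t e => [forall i, P i t e]).
Proof.
move=> HP.
apply: (fo_ext DC) (fo_not DC (fo_exI (fun i => fo_not DC (HP i)))) => t e.
by rewrite negb_exists; apply: eq_forallb => i; rewrite negbK.
Qed.

Lemma fo_eqt V (f g : 'I_k -> V) : D (fun t e => tup e f == tup e g).
Proof.
apply: (fo_ext DC) (fo_allI (fun i => fo_eq DC (f i) (g i))) => t e.
apply/forallP/eqP => [h|h i]; first by apply: tup_tnth => i; rewrite tnth_tup (eqP (h i)).
by have := congr1 (fun a => tnth a i) h; rewrite /= !tnth_tup => ->.
Qed.

Lemma fo_rel_sub V W (R : brel V) (g : V -> W) (f f' : 'I_k -> W) :
  D (rel_query R) ->
  D (fun t e => R t (fun z => e (g z)) (tup e f) (tup e f')).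
Proof.
pose h (z : V + 'I_k + 'I_k) : W :=
  match z with inl (inl x) => g x | inl (inr i) => f i | inr i => f' i end.
by move=> /(fo_sub DC h).
Qed.

Definition fcons n T (u : T) (f : 'I_n -> T) (i : 'I_n.+1) : T :=
  if unlift ord0 i is Some j then f j else u.

Lemma fcons_eta n T (f : 'I_n.+1 -> T) :
  fcons (f ord0) [ffun i => f (lift ord0 i)] = f.
Proof.
apply: functional_extensionality => i; rewrite /fcons.
by case: unliftP => [j|] ->; rewrite ?ffunE.
Qed.

Lemma fo_fcons n V (Q : forall t, (V -> node t) -> ('I_n.+1 -> node t) -> bool) :
  D (fun t (e : V + 'I_n.+1 -> node t) => Q t (fun z => e (inl z)) (fun i => e (inr i))) ->
  D (fun t (e : option V + 'I_n -> node t) =>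
       Q t (fun z => e (inl (Some z))) (fcons (e (inl None)) (fun i => e (inr i)))).
Proof.
pose g (z : V + 'I_n.+1) : option V + 'I_n :=
  match z with
  | inl z => inl (Some z)
  | inr i => if unlift ord0 i is Some j then inr j else inl None
  end.
move=> /(fo_sub DC g); apply: (fo_ext DC) => t e; congr Q.
by apply: functional_extensionality => i /=; rewrite /fcons; case: unlift.
Qed.

Lemma fo_ex_ffun n V (Q : forall t, (V -> node t) -> ('I_n -> node t) -> bool) :
  D (fun t (e : V + 'I_n -> node t) => Q t (fun z => e (inl z)) (fun i => e (inr i))) ->
  D (fun t (e : V -> node t) => [exists f : {ffun 'I_n -> node t}, Q t e f]).
Proof.
elim: n V Q => [|n IH] V Q HQ.
  pose g (z : V + 'I_0) : V :=
    match z with inl z => z | inr i => False_rect V (notF (ltn_ord i)) end.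
  apply: (fo_ext DC) (fo_sub DC g HQ) => t e /=.
  have E (f f' : 'I_0 -> node t) : f = f' by apply: functional_extensionality => -[].
  apply/idP/existsP => [h|[f]]; last by rewrite (E f (fun i => e (g (inr i)))).
  by exists [ffun i => e (g (inr i))]; rewrite (E (finfun _) (fun i => e (g (inr i)))).
have: D (fun t e => [exists u, [exists f : {ffun 'I_n -> node t}, Q t e (fcons u f)]]).
  apply: (fo_ex DC).
  exact: (IH _ (fun t e f => Q t (fun z => e (Some z)) (fcons (e None) f)) (fo_fcons HQ)).
apply: (fo_ext DC) => t e.
apply/existsP/existsP => [[u /existsP[f Qf]]|[f Qf]].
  exists [ffun i => fcons u f i]; move: Qf; congr Q.
  by apply: functional_extensionality => i; rewrite ffunE.
exists (f ord0); apply/existsP; exists [ffun i => f (lift ord0 i)].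
by rewrite fcons_eta.
Qed.

Lemma fo_ex_tup V (Q : forall t, (V -> node t) -> k.-tuple (node t) -> bool) :
  D (fun t (e : V + 'I_k -> node t) => Q t (fun z => e (inl z)) (tup e inr)) ->
  D (fun t (e : V -> node t) => [exists a, Q t e a]).
Proof.
move=> HQ.
have := fo_ex_ffun (Q := fun t e f => Q t e (tup f id)) HQ.
apply: (fo_ext DC) => t e; apply/existsP/existsP => [[f]|[a Qa]].
  by exists (tup f id).
exists [ffun i => tnth a i]; rewrite (_ : tup _ _ = a) //.
by apply: tup_tnth => i; rewrite ffunE.
Qed.

End Derived.
End Classes.

(** * Queries definable by formulas *)

Section Formulas.
Variables (Sigma : finType) (rank : Sigma -> nat) (k : nat).

Lemma sat_class (D : forall V, query rank V -> Prop) :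
  fo_class D -> dtc_closed k D ->
  forall phi : formula Sigma k, is_FO_DTC rank phi -> D nat (fun t v => sat v phi).
Proof.
move=> DC DT; have DQ (Q : query rank nat) x : D nat Q ->
    D (option nat) (fun t e => Q t [eta (fun z => e (Some z)) with x |-> e None]).
  pose g z := if z == x then None else Some z.
  move=> /(fo_sub DC g); apply: (fo_ext DC) => t e; congr Q.
  by apply: functional_extensionality => z /=; rewrite /g; case: eqP.
elim=> [s x|i x y|x y|x y|phi IH|phi IH psi IH'|phi IH psi IH'|x phi IH|x phi IH
       |xs ys phi IH us vs] /=.
- by move=> _; apply: (fo_lab DC).
- by move=> _; apply: (fo_edg DC).
- by move=> _; apply: (fo_le DC).
- by move=> _; apply: (fo_eq DC).
- by move=> /IH; apply: (fo_not DC).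
- by case=> /IH h /IH' h'; apply: (fo_and DC).
- by case=> /IH h /IH' h'; apply: (fo_or DC).
- by move=> /IH /DQ h; apply: (fo_ex DC); apply: h.
- by move=> /IH /DQ h; apply: (fo_all DC); apply: h.
case=> _ fphi /IH hphi.
pose R : brel rank k nat :=
  fun t v a b => sat (assign (assign v xs a) ys b) phi.
have fR : functional_brel R by move=> t v a b b'; apply: fphi.
have DR : D _ (rel_query R).
  pose g (z : nat) : nat + 'I_k + 'I_k :=
    if insub (index z ys) is Some i then inr i
    else if insub (index z xs) is Some i then inl (inr i) else inl (inl z).
  apply: (fo_ext DC) (fo_sub DC g hphi) => t e; rewrite /rel_query /R.
  congr sat; apply: functional_extensionality => z; rewrite /g /assign.
  have nthE (s : k.-tuple nat) x0 (f : 'I_k -> nat + 'I_k + 'I_k) (i : 'I_k) :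
      val i = index z s -> e (f i) = nth x0 (tup e f) (index z s).
    by move=> <-; rewrite -tnth_nth tnth_tup.
  case: insubP => [i|] /=; rewrite -[X in _ < X](size_tuple ys) index_mem.
    by move=> -> iz; apply: (nthE _ _ _ i).
  move=> /negbTE->; case: insubP => [i|] /=;
    rewrite -[X in _ < X](size_tuple xs) index_mem.
    by move=> -> iz; apply: (nthE _ _ (fun i => inl (inr i)) i).
  by move=> /negbTE->.
have := fo_rel_sub DC id (tnth us) (tnth vs) (DT _ R fR DR).
apply: (fo_ext DC) => t e; congr (connect _ _ _).
  by apply: eq_from_tnth => i; rewrite tnth_tup tnth_map.
by apply: eq_from_tnth => i; rewrite tnth_tup tnth_map.
Qed.

(* Quantifying over the names rho of the free variables makes definability
   stable under substitution; n bounds them, so fresh variables are at hand. *)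
Definition definable V (P : query rank V) :=
  forall (rho : V -> nat) n, (forall z, rho z < n) ->
  exists phi : formula Sigma k,
    [/\ is_FO_DTC rank phi,
        forall z, z \in free_vars phi -> exists y, z = rho y
      & forall t v, sat v phi = P t (fun z => v (rho z))].

Lemma definable_class : fo_class definable.
Proof.
split.
- move=> V W g P hP rho n lt.
  have [phi [d fv e]] := hP (fun z => rho (g z)) n (fun z => lt (g z)).
  by exists phi; split=> // z /fv[y ->]; exists (g y).
- move=> V P P' PP hP rho n lt; have [phi [d fv e]] := hP rho n lt.
  by exists phi; split=> // t v; rewrite e PP.
- move=> V P hP rho n lt; have [phi [d fv e]] := hP rho n lt.
  by exists (FNot phi); split=> // t v /=; rewrite e.
- move=> V P P' hP hP' rho n lt; have [phi [d fv e]] := hP rho n lt.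
  have [phi' [d' fv' e']] := hP' rho n lt.
  exists (FAnd phi phi'); split=> // [z|t v] /=; last by rewrite e e'.
  by rewrite mem_cat => /orP[/fv|/fv'].
- move=> V Q hQ rho n lt.
  have [|phi [d fv e]] := hQ (fun o => if o is Some z then rho z else n) n.+1.
    by move=> [z|] //; apply: (leq_trans (lt z)).
  exists (FEx n phi); split=> // [z|t v] /=.
    rewrite mem_filter => /andP[zn zf]; case: (fv _ zf) zn => -[y|] ->; first by exists y.
    by move/eqP.
  apply: eq_existsb => u; rewrite e /= eqxx; congr Q.
  by apply: functional_extensionality => z; rewrite ltn_eqF.
- move=> V s x rho n lt; exists (FLab k s (rho x)); split=> // z.
  by rewrite inE => /eqP->; exists x.
- move=> V i x y rho n lt; exists (FEdg Sigma k i (rho x) (rho y)); split=> // z.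
  by rewrite !inE => /orP[] /eqP->; [exists x|exists y].
- move=> V x y rho n lt; exists (FLe Sigma k (rho x) (rho y)); split=> // z.
  by rewrite !inE => /orP[] /eqP->; [exists x|exists y].
- move=> V x y rho n lt; exists (FEq Sigma k (rho x) (rho y)); split=> // z.
  by rewrite !inE => /orP[] /eqP->; [exists x|exists y].
Qed.

Lemma definable_dtc : dtc_closed k definable.
Proof.
move=> V R fR hR rho n lt.
pose xs := [tuple n + i | i < k]; pose ys := [tuple n + k + i | i < k].
pose sigma (z : V + 'I_k + 'I_k) :=
  match z with
  | inl (inl z) => rho (inl (inl z)) | inl (inr i) => n + i | inr i => n + k + i
  end.
have [|phi [d fv e]] := hR sigma (n + k + k).
  move=> [[z|i]|i] /=; rewrite ?ltn_add2l //.
    by rewrite -addnA (leq_trans (lt _)) ?leq_addr.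
  by rewrite -addnA ltn_add2l (leq_trans (ltn_ord i)) ?leq_addr.
have xsP z : (z \in xs) = (n <= z < n + k).
  apply/mapP/andP => [[i _ ->]|[nz zk]]; first by rewrite leq_addr ltn_add2l ltn_ord.
  have zn : z - n < k by rewrite ltn_subLR.
  by exists (Ordinal zn); rewrite ?mem_enum //= subnKC.
have ysP z : (z \in ys) = (n + k <= z < n + k + k).
  apply/mapP/andP => [[i _ ->]|[nz zk]]; first by rewrite leq_addr ltn_add2l ltn_ord.
  have zn : z - (n + k) < k by rewrite ltn_subLR.
  by exists (Ordinal zn); rewrite ?mem_enum //= subnKC.
have xsU : uniq xs.
  by rewrite map_inj_uniq ?enum_uniq // => i j /addnI /val_inj.
have ysU : uniq ys.
  by rewrite map_inj_uniq ?enum_uniq // => i j /addnI /val_inj.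
have xs_ys z : z \in xs -> z \notin ys.
  by rewrite xsP ysP => /andP[_ zk]; rewrite leqNgt zk.
have satR t (v : valuation t) a b :
    sat (assign (assign v xs a) ys b) phi = R t (fun z => v (rho (inl (inl z)))) a b.
  have asgn (w : valuation t) (s : k.-tuple nat) (c : k.-tuple (node t)) i :
      uniq s -> assign w s c (tnth s i) = tnth c i.
    move=> sU; rewrite /assign mem_tnth (tnth_nth 0) index_uniq ?size_tuple //.
    by rewrite -tnth_nth.
  rewrite e /rel_query; congr (R t _ _ _).
  - apply: functional_extensionality => z.
    have ltk := leq_trans (lt (inl (inl z))) (leq_addr k n).
    by rewrite /assign xsP ysP [n + k <= _]leqNgt ltk [n <= _]leqNgt lt.
  - apply: tup_tnth => i; rewrite -(asgn v xs a i xsU) {1}/assign /=.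
    have -> : n + i = tnth xs i by rewrite tnth_mktuple.
    by rewrite (negbTE (xs_ys _ _)) ?mem_tnth.
  - apply: tup_tnth => i; rewrite -(asgn (assign v xs a) ys b i ysU) /=.
    by rewrite tnth_mktuple.
pose us := [tuple rho (inl (inr i)) | i < k]; pose vs := [tuple rho (inr i) | i < k].
exists (FTC xs ys phi us vs); split=> /=.
- split=> //; last by move=> t v a b b'; rewrite !satR; apply: fR.
  rewrite cat_uniq xsU ysU andbT; apply/hasPn => z zy; apply/negP => /xs_ys.
  by rewrite zy.
- move=> z; rewrite !mem_cat mem_filter.
  case/or3P=> [/andP[zn /fv[y zy]]|/mapP[i _ ->]|/mapP[i _ ->]].
  + case: y zy => [[y|i]|i] zy; first by exists (inl (inl y)).
      by move: zn; rewrite mem_cat zy /= xsP leq_addr ltn_add2l ltn_ord.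
    by move: zn; rewrite mem_cat zy /= orbC ysP leq_addr ltn_add2l ltn_ord.
  + by exists (inl (inr i)).
  + by exists (inr i).
move=> t v; rewrite /rel_query.
have mapE (f : 'I_k -> nat) : map_tuple v [tuple f i | i < k] = tup v f.
  by apply: eq_from_tnth => i; rewrite tnth_map !tnth_mktuple.
by rewrite !mapE; apply: eq_connect => a b; rewrite satR.
Qed.

End Formulas.

(** * Elimination of states *)

Section Reachability.
Variables (T : finType) (G : rel T).
Hypothesis G_fun : forall c d d', G c d -> G c d' -> d = d'.

Lemma connect_fun_stuck c d d' :
  connect G c d -> connect G c d' ->
  (forall e, ~~ G d e) -> (forall e, ~~ G d' e) -> d = d'.
Proof.
move=> /connectP[s cs ->] {d}; elim: s c cs => [|x s IH] c /=.
  move=> _ /connectP[[|y s'] //= /andP[cy _] _] nc _.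
  by have := nc y; rewrite cy.
case/andP=> cx xs /connectP[[|y s'] /= cs' Ed'] nd nd'.
  by have := nd' x; rewrite Ed' cx.
case/andP: cs' => cy ys'; apply: (IH x) => //.
by rewrite (G_fun cx cy); apply/connectP; exists s'.
Qed.

End Reachability.

Section Kleene.
Variables (Q T : finType) (G : rel (Q * T)).
Implicit Types (c d e : Q * T) (S : seq Q).

Fixpoint kleene S c d : bool :=
  if S is r :: S' then
    kleene S' c d ||
    [exists x, [exists y,
       [&& kleene S' c (r, x),
           connect (fun a b => kleene S' (r, a) (r, b)) x y
         & kleene S' (r, y) d]]]
  else G c d.

(* Nonempty G-paths all of whose intermediate states lie in S. *)
Inductive via S : Q * T -> Q * T -> Prop :=
| Via1 c d : G c d -> via S c d
| ViaS c e d : G c e -> e.1 \in S -> via S e d -> via S c d.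

Lemma via_trans S c e d : via S c e -> e.1 \in S -> via S e d -> via S c d.
Proof.
elim=> [c' e' ce eS ed|c' e1 d' ce1 e1S _ IH dS ed]; first exact: ViaS ce eS ed.
by apply: ViaS ce1 e1S _; apply: IH.
Qed.

Lemma via_sub S S' c d : {subset S <= S'} -> via S c d -> via S' c d.
Proof.
move=> sub; elim=> [*|c' e d' ce eS _ ed]; first exact: Via1.
exact: ViaS ce (sub _ eS) ed.
Qed.

Lemma kleeneP S c d : kleene S c d <-> via S c d.
Proof.
elim: S c d => [|r S IH] c d /=.
  split=> [|h]; first exact: Via1.
  by case: h => // c' e d' _; rewrite in_nil.
have subS : {subset S <= r :: S} by move=> x; rewrite inE orbC => ->.
have rS : r \in r :: S by rewrite inE eqxx.
split.
  case/orP=> [/IH|/existsP[x /existsP[y /and3P[/IH cx /connectP[s xs ->] /IH yd]]]].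
    exact: via_sub.
  apply: (via_trans (via_sub subS cx) rS).
  elim: s x xs yd {cx} => [|z s IHs] x /=; first by move=> _; apply: via_sub.
  case/andP=> /IH xz zs yd.
  exact: (via_trans (via_sub subS xz) rS (IHs _ zs yd)).
elim=> {c d} [c d cd|c e d ce eS _].
  by apply/orP; left; apply/IH; apply: Via1.
have [er|ner] := eqVneq e.1 r; last first.
  have {eS ner} eS : e.1 \in S by move: eS; rewrite inE (negbTE ner).
  case/orP=> [/IH ed|/existsP[x /existsP[y /and3P[/IH ex xy yd]]]]; apply/orP.
    by left; apply/IH; exact: (ViaS ce eS ed).
  right; apply/existsP; exists x; apply/existsP; exists y; apply/and3P; split=> //.
  by apply/IH; exact: (ViaS ce eS ex).
have [z ez] : exists z, e = (r, z).
  by exists e.2; rewrite -er -surjective_pairing.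
rewrite {e er eS}ez in ce * => h; apply/orP; right; apply/existsP; exists z.
have cz' : kleene S c (r, z) by apply/IH; apply: Via1.
case/orP: h => [zd|/existsP[x /existsP[y /and3P[zx xy yd]]]]; apply/existsP.
  by exists z; rewrite cz' connect0.
by exists y; rewrite cz' yd andbT; apply: connect_trans xy; apply: connect1.
Qed.

Lemma kleene_connect c d : connect G c d = (c == d) || kleene (enum Q) c d.
Proof.
apply/idP/orP => [/connectP[s cs ->]|[/eqP->|/kleeneP h]]; first last.
- elim: h => [c' d'|c' e d' ce _ _ ed]; first exact: connect1.
  exact: (connect_trans (connect1 ce) ed).
- exact: connect0.
elim: s c cs => [|e s IH] c /=; first by rewrite eqxx; left.
case/andP=> ce /IH[/eqP<-|/kleeneP h]; right; apply/kleeneP; first exact: Via1.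
by apply: (ViaS ce _ h); rewrite mem_enum.
Qed.

Hypothesis G_fun : forall c d d', G c d -> G c d' -> d = d'.

(* The first visit to r along the unique G-path is unique. *)
Lemma kleene_fun S c r x y :
  r \notin S -> kleene S c (r, x) -> kleene S c (r, y) -> x = y.
Proof.
move=> rS /kleeneP h /kleeneP h'.
suff vf c' d d' : via S c' d -> via S c' d' -> d.1 = r -> d'.1 = r -> d = d'.
  by have [] := vf _ _ _ h h' erefl erefl.
move=> {}h; elim: h d' => {c c' x y h' d} [c d cd|c e d ce eS _ IH] d' h'.
  case: h' cd => {c d'} [c d' cd'|c e d' ce eS _] cd dr.
    by rewrite (G_fun cd cd').
  by rewrite -(G_fun cd ce) dr (negbTE rS) in eS.
case: h' ce => {c d'} [c d' cd'|c e' d' ce' _ h'] ce.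
  by move=> _ d'r; rewrite (G_fun ce cd') d'r (negbTE rS) in eS.
by apply: IH; rewrite (G_fun ce ce').
Qed.

End Kleene.

Section KleeneQuery.
Variables (Sigma : finType) (rank : Sigma -> nat) (k : nat).
Variables (D : forall V, query rank V -> Prop).
Hypotheses (DC : fo_class D) (DT : dtc_closed k D).
Variables (Q : finType) (V : Type).
Variable G : forall t : tree rank, (V -> node t) -> rel (Q * k.-tuple (node t)).
Hypothesis G_fun : forall t e c d d', @G t e c d -> @G t e c d' -> d = d'.
Hypothesis DG : forall p q,
  D (rel_query (k := k) (fun t e a b => @G t e (p, a) (q, b))).

Lemma fo_kleene S p q : uniq S ->
  D (rel_query (k := k) (fun t e a b => kleene (@G t e) S (p, a) (q, b))).
Proof.
elim: S p q => [|r S IH] p q; first by move=> _; apply: DG.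
case/andP=> rS uS; have {}IH p' q' := IH p' q' uS.
have star := DT (fun t e a b b' => kleene_fun (@G_fun t e) rS) (IH r r).
rewrite /rel_query /=; apply: (fo_or DC); first exact: IH.
apply: (fo_ex_tup DC); apply: (fo_ex_tup DC); apply: (fo_and DC).
  exact: (fo_rel_sub DC (fun z => inl (inl (inl (inl z))))
                    (fun i => inl (inl (inl (inr i)))) (fun i => inl (inr i)) (IH p r)).
apply: (fo_and DC).
  exact: (fo_rel_sub DC (fun z => inl (inl (inl (inl z))))
                    (fun i => inl (inr i)) inr star).
exact: (fo_rel_sub DC (fun z => inl (inl (inl (inl z))))
                    inr (fun i => inl (inl (inr i))) (IH r q)).
Qed.

Lemma fo_connect_state p q :
  D (rel_query (k := k) (fun t e a b => connect (@G t e) (p, a) (q, b))).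
Proof.
apply: (@fo_ext _ _ _ DC _ (rel_query (k := k) (fun t e a b =>
   (p == q) && (a == b) || kleene (@G t e) (enum Q) (p, a) (q, b)))).
  by move=> t e; rewrite /rel_query kleene_connect.
apply: (fo_or DC); last exact: (fo_kleene p q (enum_uniq Q)).
apply: (fo_and DC); [exact: fo_const|exact: (fo_eqt DC)].
Qed.

End KleeneQuery.

Section Heads.
Variables (Sigma : finType) (rank : Sigma -> nat) (k : nat) (t : tree rank).
Implicit Type u : heads k t.

Lemma tnth_move u i w j : tnth (move_head u i w) j = if j == i then w else tnth u j.
Proof. by rewrite tnth_mktuple. Qed.

Lemma move_move u i w w' : move_head (move_head u i w) i w' = move_head u i w'.
Proof. by apply: eq_from_tnth => j; rewrite !tnth_move; case: eqP. Qed.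

Lemma move_id u i : move_head u i (tnth u i) = u.
Proof. by apply: eq_from_tnth => j; rewrite tnth_move; case: eqP => [->|]. Qed.

End Heads.

(** * From automata to formulas *)

Section AutomatonToFormula.
Variables (Sigma : finType) (rank : Sigma -> nat) (k : nat).

Section Moves.
Variable X : finType.
Implicit Types (chi : op Sigma k X).

Definition stk (t : tree rank) (xs : seq X) (w : X -> node t) : stack X t :=
  [seq (x, w x) | x <- xs].

Lemma mem_stk (t : tree rank) xs (w : X -> node t) x v :
  ((x, v) \in stk xs w) = (x \in xs) && (w x == v).
Proof.
apply/mapP/andP => [[y yxs [-> ->]]|[xxs /eqP<-]]; first by rewrite eqxx.
by exists x.
Qed.

Lemma stk_names (t : tree rank) xs (w : X -> node t) :
  [seq pn.1 | pn <- stk xs w] = xs.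
Proof. by rewrite -map_comp map_id_in. Qed.

Lemma stk_upd (t : tree rank) xs (w : X -> node t) x v :
  x \notin xs -> stk xs [eta w with x |-> v] = stk xs w.
Proof.
move=> xxs; apply/eq_in_map => y yxs /=; case: eqP => // yx.
by rewrite -yx yxs in xxs.
Qed.

Definition plain chi : bool :=
  match chi with Drop _ _ | Retrieve _ => false | _ => true end.

Definition move (t : tree rank) chi (u : heads k t) (alpha : stack X t) v : bool :=
  match chi with
  | Up i => [exists j : 'I_(max_rank rank).+1, [exists w,
               is_child j w (tnth u i) && (v == move_head u i w)]]
  | Down i j => [exists w, is_child j (tnth u i) w && (v == move_head u i w)]
  | Pos tau => test_holds tau u alpha && (v == u)
  | Neg tau => ~~ test_holds tau u alpha && (v == u)
  | _ => false
  end.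

Lemma execE (t : tree rank) chi (c d : heads k t * stack X t) :
  exec chi c d ->
  match chi with
  | Up i => exists j w, is_child j w (tnth c.1 i) /\ d = (move_head c.1 i w, c.2)
  | Down i j => exists w, is_child j (tnth c.1 i) w /\ d = (move_head c.1 i w, c.2)
  | Drop i x => x \notin [seq pn.1 | pn <- c.2] /\ d = (c.1, (x, tnth c.1 i) :: c.2)
  | Retrieve x => exists w, c.2 = (x, w) :: d.2 /\ d.1 = c.1
  | Pos tau => test_holds tau c.1 c.2 /\ d = c
  | Neg tau => ~~ test_holds tau c.1 c.2 /\ d = c
  end.
Proof.
case=> {chi c d} /= [i j w u alpha wu|i j w u alpha uw|i x u alpha xu|x w u alpha
  |tau u alpha h|tau u alpha h] //.
- by exists j, w.
- by exists w.
- by exists w.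
Qed.

Lemma moveP (t : tree rank) chi (u : heads k t) alpha v beta :
  plain chi ->
  exec chi (u, alpha) (v, beta) <-> move chi u alpha v /\ beta = alpha.
Proof.
move=> pl; split=> [/execE|[]].
  case: chi pl => //= [i|i j|tau|tau] _.
  - case=> j [w [wu [-> ->]]]; split=> //; apply/existsP.
    exists (Ordinal (is_child_max wu : j < (max_rank rank).+1)).
    by apply/existsP; exists w; rewrite wu eqxx.
  - by case=> w [wu [-> ->]]; split=> //; apply/existsP; exists w; rewrite wu eqxx.
  - by case=> h [-> ->]; rewrite h eqxx.
  - by case=> h [-> ->]; rewrite h eqxx.
case: chi pl => //= [i|i j|tau|tau] _.
- by move=> /existsP[j /existsP[w /andP[wu /eqP->]]] ->; apply: ExecUp wu.
- by move=> /existsP[w /andP[wu /eqP->]] ->; apply: ExecDown wu.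
- by move=> /andP[h /eqP->] ->; apply: ExecPos.
- by move=> /andP[h /eqP->] ->; apply: ExecNeg.
Qed.

Lemma move_fun (t : tree rank) chi (u : heads k t) alpha v v' :
  move chi u alpha v -> move chi u alpha v' -> v = v'.
Proof.
case: chi => //= [i|i j|tau|tau].
- move=> /existsP[j /existsP[w /andP[wu /eqP->]]].
  move=> /existsP[j' /existsP[w' /andP[wu' /eqP->]]].
  by rewrite (is_child_inj wu wu').
- move=> /existsP[w /andP[wu /eqP->]] /existsP[w' /andP[wu' /eqP->]].
  by rewrite (is_child_fun wu wu').
- by move=> /andP[_ /eqP->] /andP[_ /eqP->].
- by move=> /andP[_ /eqP->] /andP[_ /eqP->].
Qed.

Variables (D : forall V, query rank V -> Prop) (DC : fo_class D).

Lemma fo_eq_move V (f g : 'I_k -> V) i z :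
  D (fun t e => tup e f == move_head (tup e g) i (e z)).
Proof.
apply: (fo_ext DC) (fo_allI DC (fun j => fo_eq DC (f j) (if j == i then z else g j))).
move=> t e; apply/forallP/eqP => h.
  by apply: eq_from_tnth => j; rewrite tnth_move !tnth_tup (eqP (h j)); case: eqP.
move=> j; have := congr1 (fun a => tnth a j) h.
by rewrite /= tnth_move !tnth_tup => ->; case: (j == i).
Qed.

Lemma fo_test tau xs : D (fun t (e : X + 'I_k + 'I_k -> node t) =>
  test_holds tau (tup e (fun i => inl (inr i))) (stk xs (fun x => e (inl (inl x))))).
Proof.
case: tau => [i s|i x|i j].
- apply: (fo_ext DC) (fo_lab DC s (inl (inr i))) => t e /=.
  by rewrite tnth_tup.
- apply: (fo_ext DC) (fo_and DC (fo_const DC _ (x \in xs))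
                               (fo_eq DC (inl (inl x)) (inl (inr i)))) => t e /=.
  by rewrite mem_stk tnth_tup.
case: j => [|j].
  apply: (fo_ext DC) (fo_all DC (Q := fun t e u => is_ancestor (e (inl (inr i))) u)
    (fo_le DC (Some (inl (inr i))) None)) => t e /=.
  by rewrite tnth_tup root_ancestor child_number_eq0.
apply: (fo_ext DC) (fo_ex DC (Q := fun t e u => is_child j.+1 u (e (inl (inr i))))
    (fo_edg DC j.+1 None (Some (inl (inr i))))) => t e /=.
rewrite tnth_tup; apply/existsP/eqP => [[u /is_child_num]//|uj].
have [w] : exists w, is_child (child_number (e (inl (inr i)))) w (e (inl (inr i))).
  by apply: ex_parent; rewrite -child_number_eq0 uj.
by rewrite uj; exists w.
Qed.

Lemma fo_move chi xs :
  D (rel_query (fun t e a b => move chi a (stk xs e) b)).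
Proof.
rewrite /rel_query; case: chi => [i|i j|i x|x|tau|tau] /=; try exact: fo_const.
- apply: (fo_exI DC) => j; apply: (fo_ex DC); apply: (fo_and DC).
    apply: (fo_ext DC) (fo_edg DC j None (Some (inl (inr i)))) => t e.
    by rewrite tnth_tup.
  exact: fo_eq_move.
- apply: (fo_ex DC); apply: (fo_and DC).
    apply: (fo_ext DC) (fo_edg DC j (Some (inl (inr i))) None) => t e.
    by rewrite tnth_tup.
  exact: fo_eq_move.
- by apply: (fo_and DC); [apply: fo_test|apply: (fo_eqt DC)].
- by apply: (fo_and DC); [apply: (fo_not DC); apply: fo_test|apply: (fo_eqt DC)].
Qed.

End Moves.

Variables (A : ptwa Sigma k) (Adet : deterministic A).
Let X := pebble A.
Let I := instructions A.

Lemma det_instr p c c' q q' : (p, c, q) \in I -> (p, c', q') \in I ->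
  (c = c' /\ q = q') \/
  exists tau, (c = Pos tau /\ c' = Neg tau) \/ (c = Neg tau /\ c' = Pos tau).
Proof.
move=> h h'; have [[-> ->]|/(Adet h h')] := eqVneq (p, c, q) (p, c', q'); first by left.
by right.
Qed.

(* [macro m xs w] relates the successive configurations of A whose stack is
   exactly the pebbles xs, placed according to w, when the stack never
   sinks below that level in between; m bounds the number of pebbles that can
   still be dropped. *)
Fixpoint macro m (xs : seq X) (t : tree rank) (w : X -> node t) :
    rel (state A * k.-tuple (node t)) :=
  fun c d => has (fun ins : state A * op Sigma k X * state A =>
    (ins.1.1 == c.1) &&
    match ins.1.2 with
    | Drop i x =>
        if m is m'.+1 then
          (x \notin xs) &&
          [exists q, ((q, Retrieve x, d.1) \in I) &&
             connect (macro m' (x :: xs) [eta w with x |-> tnth c.2 i])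
                     (ins.2, c.2) (q, d.2)]
        else false
    | Retrieve _ => false
    | chi => (ins.2 == d.1) && move chi c.2 (stk xs w) d.2
    end) I.

Lemma macroP m xs t (w : X -> node t) p a q b :
  macro m xs w (p, a) (q, b) <->
  (exists chi, [/\ (p, chi, q) \in I, plain chi & move chi a (stk xs w) b]) \/
  (exists i x p' q' m', [/\ m = m'.+1, (p, Drop i x, p') \in I, x \notin xs,
     (q', Retrieve x, q) \in I
   & connect (macro m' (x :: xs) [eta w with x |-> tnth a i]) (p', a) (q', b)]).
Proof.
split.
  case: m => [|m] /= /hasP[[[p' chi] q'] insI /= /andP[/eqP pp']].
    rewrite pp' in insI; case: chi insI => // [i|i j|tau|tau] insI /andP[/eqP<- h];
    by left; eexists; split; first exact: insI.
  rewrite pp' in insI; case: chi insI => // [i|i j|i x|tau|tau] insI;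
    try by move=> /andP[/eqP<- h]; left; eexists; split; first exact: insI.
  case/andP=> xxs /existsP[r /andP[rI h]]; right.
  by exists i, x, q', r, m.
case=> [[chi [insI pl h]]|[i [x [p' [q' [m' [-> insI xxs rI h]]]]]]].
  case: m => [|m]; apply/hasP; exists (p, chi, q) => //=; rewrite eqxx /=;
  by case: chi pl h {insI} => //= *; rewrite eqxx.
apply/hasP; exists (p, Drop i x, p') => //=; rewrite eqxx xxs /=.
by apply/existsP; exists q'; rewrite rI.
Qed.

Lemma macro_retrieve m xs t (w : X -> node t) q x r b e :
  (q, Retrieve x, r) \in I -> ~~ macro m xs w (q, b) e.
Proof.
move=> qr; apply/negP; case: e => p a /macroP[[chi [qp]]|[i [y [p' [q' [m' [_ qp]]]]]]].
  by have [[<- _]|[tau [[]|[]]]] := det_instr qr qp.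
by have [[]|[tau [[]|[]]]] := det_instr qr qp.
Qed.

Lemma macro_fun m xs t (w : X -> node t) c d d' :
  macro m xs w c d -> macro m xs w c d' -> d = d'.
Proof.
elim: m xs w c d d' => [|m IH] xs w [p a] [q b] [q' b'] /macroP h /macroP h'.
all: case: h => [[chi [pq pl mv]]|[i [x [r [s [m1 [// em pr xxs sq st]]]]]]].
all: case: h' => [[chi' [pq' pl' mv']]|[i' [x' [r' [s' [m1' [// em' pr' xxs' sq' st']]]]]]].
- have [[E ->]|[tau [[E E']|[E E']]]] := det_instr pq pq'; subst.
  + by rewrite (move_fun mv mv').
  + by case/andP: mv mv' => /= -> _.
  + by case/andP: mv' mv => /= -> _.
- have [[E ->]|[tau [[E E']|[E E']]]] := det_instr pq pq'; subst.
  + by rewrite (move_fun mv mv').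
  + by case/andP: mv mv' => /= -> _.
  + by case/andP: mv' mv => /= -> _.
- by have [[E _]|[tau [[E E']|[E E']]]] := det_instr pq pr'; subst.
- by have [[E _]|[tau [[E E']|[E E']]]] := det_instr pr pq'; subst.
have [[[Ei Ex] Er]|[tau [[E E']|[E E']]]] := det_instr pr pr'; subst => //.
case: em => Em; case: em' => Em'; subst.
have [E1 E2] : (s, b) = (s', b').
  by apply: (connect_fun_stuck (@IH _ _) st st') => e; apply: macro_retrieve;
     [exact: sq|exact: sq'].
subst; by have [[E ->]|[tau [[]|[]]]] := det_instr sq sq'.
Qed.

Variables (D : forall V, query rank V -> Prop).
Hypotheses (DC : fo_class D) (DT : dtc_closed k D).

Lemma fo_macro m xs p q :
  D (rel_query (fun t e a b => @macro m xs t e (p, a) (q, b))).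
Proof.
elim: m xs p q => [|m IH] xs p q.
all: rewrite /rel_query /=; apply: (fo_has DC) => -[[p' chi] q'] /=.
all: apply: (fo_and DC); first exact: fo_const.
all: have mv chi' := fo_and DC (fo_const DC _ (q' == q)) (fo_move DC chi' xs).
all: case: chi => [i|i j|i x|x|tau|tau]; try exact: fo_const.
all: try first [exact: (mv (Up i))|exact: (mv (Down i j))|exact: (mv (Pos tau))
               |exact: (mv (Neg tau))].
apply: (fo_and DC); first exact: fo_const.
apply: (fo_exI DC) => r; apply: (fo_and DC); first exact: fo_const.
have star := fo_connect_state DC DT
  (fun t e c d d' => @macro_fun m (x :: xs) t e c d d') (IH (x :: xs)) q' r.
pose g y : X + 'I_k + 'I_k := if y == x then inl (inr i) else inl (inl y).
apply: (fo_ext DC) (fo_rel_sub DC g (fun i => inl (inr i)) inr star) => t e /=.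
congr (connect (macro m (x :: xs) _) _ _).
by apply: functional_extensionality => y /=; rewrite /g tnth_tup; case: eqP.
Qed.

Section Run.
Variable t : tree rank.

Local Notation steps := (clos_refl_trans _ (@step Sigma rank k A t)).

Lemma macro_connect_steps m xs (w : X -> node t) p a q b :
  connect (macro m xs w) (p, a) (q, b) -> steps (p, (a, stk xs w)) (q, (b, stk xs w)).
Proof.
have clo n ys v : (forall p a q b, macro n ys v (p, a) (q, b) ->
      steps (p, (a, stk ys v)) (q, (b, stk ys v))) ->
    forall p a q b, connect (macro n ys v) (p, a) (q, b) ->
      steps (p, (a, stk ys v)) (q, (b, stk ys v)).
  move=> h p1 a1 q1 b1 /connectP[cs cs1 Ed].
  elim: cs p1 a1 cs1 Ed => [|[r c] cs IH] p1 a1 /=.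
    by move=> _ [-> ->]; apply: rt_refl.
  move=> prcs Ed; case/andP: prcs => pr cs'.
  apply: (rt_trans _ _ _ _ _ (h _ _ _ _ pr) (IH _ _ cs' Ed)).
apply: (clo); elim: m xs w {p a q b} => [|m IH] xs w p a q b /macroP.
all: case=> [[chi [pq pl mv]]|[i [x [r [s [m1 [// em pr xxs sq st]]]]]]].
- by apply: rt_step; exists chi => //; apply/moveP.
- by apply: rt_step; exists chi => //; apply/moveP.
case: em st => <- /(clo _ _ _ (IH _ _)); rewrite /= eqxx stk_upd // => st.
apply: (rt_trans _ _ _ _ _ (rt_step _ _ _ _ _) (rt_trans _ _ _ _ _ st (rt_step _ _ _ _ _))).
  by exists (Drop i x) => //=; apply: ExecDrop; rewrite stk_names.
by exists (Retrieve x) => //=; apply: ExecRetrieve.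
Qed.

Variables (w0 : X -> node t) (p0 : state A) (u0 : heads k t).

(* What is known of a configuration reached from (p0, u0) with empty stack:
   every stacked pebble was dropped at some point, and since then the macro
   steps of its level have been followed. *)
Fixpoint history (xs : seq X) (w : X -> node t) (c : state A * k.-tuple (node t)) :
    Prop :=
  if xs is x :: xs' then
    exists w' p u r i,
      [/\ history xs' w' (p, u), (p, Drop i x, r) \in I, x \notin xs',
          connect (macro (#|X| - size xs) xs w) (r, u) c
        & w = [eta w' with x |-> tnth u i]]
  else w = w0 /\ connect (macro #|X| [::] w0) (p0, u0) c.

Lemma history_step xs w p u q c : history xs w (p, u) ->
  macro (#|X| - size xs) xs w (p, u) (q, c) -> history xs w (q, c).
Proof.
case: xs => [|x xs] /=.
  by case=> -> h; rewrite subn0 => /connect1 /(connect_trans h).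
case=> w' [p' [u' [r [i [h pr xxs st Ew]]]]] /connect1 m.
by exists w', p', u', r, i; split=> //; exact: (connect_trans st m).
Qed.

Lemma history_run d : steps (p0, (u0, [::])) d ->
  exists xs w, [/\ uniq xs, d.2.2 = stk xs w & history xs w (d.1, d.2.1)].
Proof.
move=> /clos_rt_rtn1_iff; elim=> [|[p [u al]] [q [v be]] [chi /= pq ex] _].
  by exists [::], w0; split=> //=; split=> //; apply: connect0.
case=> xs [w [/= uxs eal h]]; subst al.
have := @moveP _ _ chi u (stk xs w) v be.
case pl: (plain chi).
  move=> /(_ isT)[/(_ ex)[mv ->] _]; exists xs, w; split=> //=.
  by apply: (history_step h); apply/macroP; left; exists chi.
move=> _; case: chi pl pq ex => // [i x|x] _ pq /execE /=.
  case=> xxs [-> ->]; rewrite stk_names in xxs.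
  exists (x :: xs), [eta w with x |-> tnth u i].
  split=> /=; rewrite ?xxs ?eqxx ?stk_upd //.
  by exists w, p, u, q, i; split=> //; apply: connect0.
case=> z [est ->]; case: xs uxs h est => [|y xs] //= /andP[yxs uxs] h [exy _ <-].
rewrite {y}exy in yxs h *.
case: h => w' [p' [u' [r [i [h pr _ st ew']]]]].
exists xs, w'; split=> //; first by rewrite ew' stk_upd.
apply: (history_step h); apply/macroP; right.
exists i, x, r, p, (#|X| - (size xs).+1); split=> //; last by rewrite -ew'.
suff ltX : size xs < #|X| by rewrite subnSK.
have /card_uniqP : uniq (x :: xs) by rewrite /= yxs.
by rewrite -[_ < _]/(size (x :: xs) <= _) => <-; apply: max_card.
Qed.

Lemma stepsP q v :
  steps (p0, (u0, [::])) (q, (v, [::])) <->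
  connect (macro #|X| [::] w0) (p0, u0) (q, v).
Proof.
split=> [/history_run[[|x xs] [w [_ //= _ [_ ->]]]] //|].
exact: macro_connect_steps.
Qed.

Definition stops (u : heads k t) (p : state A) : bool :=
  ~~ has (fun ins : state A * op Sigma k X * state A =>
       (ins.1.1 == p) &&
       match ins.1.2 with
       | Drop _ _ => true
       | Retrieve _ => false
       | chi => [exists v, move chi u (stk [::] w0) v]
       end) I.

Lemma stopsP u p : stops u p <-> halting ((p, (u, [::])) : config A t).
Proof.
split=> [/hasPn h [q [v al]] [chi /= pq ex]|h].
  have /= := h _ pq; rewrite eqxx /=.
  case: chi pq ex => [i|i j|i x|x|tau|tau] // _ ex.
  1,2,4,5: by apply/negP/negPn/existsP; exists v; have [] := (moveP _ _ _ _ _).1 ex.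
  by case: (execE ex) => w [].
apply/hasPn => -[[p' chi] q] pq /=; apply/negP => /andP[/eqP ep].
rewrite {p'}ep in pq; case: chi pq => [i|i j|i x|x|tau|tau] // pq.
1,2,4,5: by move=> /existsP[v mv]; apply: (h (q, (v, [::]))); eexists; [exact: pq|apply/moveP].
by move=> _; apply: (h (q, (u, [:: (x, tnth u i)]))); exists (Drop i x) => //; apply: ExecDrop.
Qed.

End Run.

Definition acceptance : query rank void := fun t e =>
  [exists r, [forall w, is_ancestor r w] &&
  [exists p, (p \in accepting A) &&
    (connect (macro #|X| [::] (fun=> r))
       (init A, tup (fun=> r) id) (p, tup (fun=> r) id) &&
     stops (fun=> r) (tup (fun=> r) id : heads k t) p)]].

Lemma fo_acceptance : D acceptance.
Proof.
apply: (fo_ex DC); apply: (fo_and DC); first exact: (fo_all DC (fo_le DC _ _)).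
apply: (fo_exI DC) => p; apply: (fo_and DC); first exact: fo_const.
apply: (fo_and DC).
  have := fo_connect_state DC DT (fun t e c d d' => @macro_fun #|X| [::] t e c d d')
    (fo_macro #|X| [::]) (init A) p.
  exact: (fo_rel_sub DC (fun=> None) (fun=> None) (fun=> None)).
apply: (fo_not DC); apply: (fo_has DC) => -[[p' chi] q] /=.
apply: (fo_and DC); first exact: fo_const.
have mv : D (fun t (e : option void -> node t) =>
    [exists v, move chi (tup e (fun=> None)) (stk [::] (fun=> e None)) v]).
  apply: (fo_ex_tup DC).
  exact: (fo_rel_sub DC (fun=> inl None) (fun=> inl None) inr (fo_move DC chi [::])).
by case: chi mv => [i|i j|i x|x|tau|tau] mv; first [exact: mv
  |exact: (fo_const DC _ true)|exact: (fo_const DC _ false)].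
Qed.

Lemma acceptanceP t e : accepts A t <-> @acceptance t e.
Proof.
have rootE : nseq_tuple k (root t) = tup (fun=> root t) id.
  by apply: eq_from_tnth => i; rewrite tnth_nseq tnth_tup.
split=> [[p [accp run halt]]|/existsP[r /andP[]]].
  apply/existsP; exists (root t); rewrite root_ancestor eqxx /=.
  apply/existsP; exists p; rewrite accp /=; move: run halt.
  rewrite /root_config rootE => /(stepsP (fun=> root t))-> /=.
  by move=> halt; apply/(stopsP (fun=> root t)).
rewrite root_ancestor => /eqP-> /existsP[p /and3P[accp run halt]].
exists p; split=> //; rewrite /root_config rootE; first exact/(stepsP (fun=> root t)).
exact/(stopsP (fun=> root t)).
Qed.

End AutomatonToFormula.

Theorem automaton_formula (Sigma : finType) (rank : Sigma -> nat) k
    (A : ptwa Sigma k) : deterministic A ->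
  exists phi : formula Sigma k,
    [/\ closed_formula phi, is_FO_DTC rank phi
      & forall t : tree rank, accepts A t <-> models t phi].
Proof.
move=> Adet.
have [|phi [dtc fv e]] := fo_acceptance Adet (definable_class rank k)
  (@definable_dtc _ rank k) (fun z : void => match z with end) 0.
  by case.
exists phi; split=> //.
  rewrite /closed_formula; case: (free_vars phi) fv => // z s fv.
  by have [|[]] := fv z; rewrite inE ?eqxx.
by move=> t; rewrite /models e; apply: acceptanceP.
Qed.

(** * Programs *)

Section Programs.
Variables (Sigma : finType) (rank : Sigma -> nat) (k : nat) (X : finType).

Definition det_code (L T : finType) (s : seq (L * op Sigma k X * T)) :=
  forall p c c' q q', (p, c, q) \in s -> (p, c', q') \in s ->
  (c = c' /\ q = q') \/
  exists tau, (c = Pos tau /\ c' = Neg tau) \/ (c = Neg tau /\ c' = Pos tau).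

Definition relocate (L T L' T' : finType) (f : L -> L') (g : T -> T')
    (s : seq (L * op Sigma k X * T)) : seq (L' * op Sigma k X * T') :=
  [seq (f i.1.1, i.1.2, g i.2) | i <- s].

Lemma relocate_in (L T L' T' : finType) (f : L -> L') (g : T -> T') s a chi b :
  (a, chi, b) \in s -> (f a, chi, g b) \in relocate f g s.
Proof. by move=> h; apply/mapP; exists (a, chi, b). Qed.

Lemma det_relocate (L T L' T' : finType) (f : L -> L') (g : T -> T') s :
  injective f -> det_code s -> det_code (relocate f g s).
Proof.
move=> fI det p c c' q q' /mapP[[[a c1] b] h [-> -> ->]].
move=> /mapP[[[a' c2] b'] h' [/fI aa -> ->]] /=; rewrite /= -aa in h'.
by have [[-> ->]|] := det _ _ _ _ _ h h'; [left|right].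
Qed.

(* A fragment of a deterministic automaton, with two exits for yes and no. *)
Record prog := Prog {
  loc : finType;
  entry : loc;
  code : seq (loc * op Sigma k X * (loc + bool));
  code_det : det_code code
}.

Variable t : tree rank.
Implicit Types (c d : heads k t * stack X t) (P : prog).

Inductive reach P : loc P -> heads k t * stack X t -> bool ->
    heads k t * stack X t -> Prop :=
| ReachExit a c chi b d :
    (a, chi, inr b) \in code P -> exec chi c d -> reach a c b d
| ReachStep a c chi a' c' b d :
    (a, chi, inl a') \in code P -> exec chi c c' -> reach a' c' b d ->
    reach a c b d.

Definition runs P c b d := reach (entry P) c b d.

Lemma reach_relocate P P' (f : loc P -> loc P') g a c b d :
  {subset relocate f g (code P) <= code P'} ->
  (forall a, g (inl a) = inl (f a)) ->
  reach a c b d ->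
  (forall b', g (inr b) = inr b' -> reach (f a) c b' d) /\
  (forall a' b' d', g (inr b) = inl a' -> reach a' d b' d' -> reach (f a) c b' d').
Proof.
move=> sub gE; elim=> {a c b d} [a c chi b d h ex|a c chi a' c' b d h ex _ [IH IH']];
  have {}h := sub _ (relocate_in f g h); split.
- by move=> b' gb; apply: ReachExit ex; rewrite -gb.
- by move=> a' b' d' gb; apply: ReachStep ex; rewrite -gb.
- by move=> b' /IH; apply: ReachStep ex; rewrite -gE.
- by move=> a1 b' d' gb /(IH' _ _ _ gb); apply: ReachStep ex; rewrite -gE.
Qed.

Fact do_det chi : det_code [:: (tt, chi, inr true : unit + bool)].
Proof.
by move=> p c c' q q'; rewrite !inE => /eqP[_ -> ->] /eqP[_ -> ->]; left.
Qed.
Definition perform chi := Prog tt (@do_det chi).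

Lemma runs_perform chi c d : exec chi c d -> runs (perform chi) c true d.
Proof. by move=> ex; apply: ReachExit ex; rewrite inE. Qed.

Fact ask_det tau (b b' : bool) :
  det_code [:: (tt, Pos tau, inr b : unit + bool); (tt, Neg tau, inr b')].
Proof.
move=> p c c' q q'; rewrite !inE => /orP[] /eqP[_ -> ->] /orP[] /eqP[_ -> ->].
- by left.
- by right; exists tau; left.
- by right; exists tau; right.
- by left.
Qed.
Definition ask tau b b' := Prog tt (@ask_det tau b b').

Lemma runs_ask tau b b' u alpha :
  runs (ask tau b b') (u, alpha) (if test_holds tau u alpha then b else b') (u, alpha).
Proof.
case: ifPn => h; first by apply: ReachExit (ExecPos h); rewrite inE eqxx.
by apply: ReachExit (ExecNeg h); rewrite !inE eqxx orbT.
Qed.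

Section Cond.
Variables P1 P2 P3 : prog.
Let L : finType := (loc P1 + loc P2 + loc P3)%type.
Let f1 (a : loc P1) : L := inl (inl a).
Let f2 (a : loc P2) : L := inl (inr a).
Let f3 (a : loc P3) : L := inr a.
Let g1 x : L + bool :=
  inl match x with inl a => f1 a | inr b => if b then f2 (entry P2) else f3 (entry P3) end.
Let g2 x : L + bool := match x with inl a => inl (f2 a) | inr b => inr b end.
Let g3 x : L + bool := match x with inl a => inl (f3 a) | inr b => inr b end.
Let cond_code := relocate f1 g1 (code P1) ++ relocate f2 g2 (code P2)
                 ++ relocate f3 g3 (code P3).

Fact cond_det : det_code cond_code.
Proof.
have d1 : det_code (relocate f1 g1 (code P1)).
  by apply: det_relocate (@code_det P1) => a b [].
have d2 : det_code (relocate f2 g2 (code P2)).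
  by apply: det_relocate (@code_det P2) => a b [].
have d3 : det_code (relocate f3 g3 (code P3)).
  by apply: det_relocate (@code_det P3) => a b [].
move=> p c c' q q'; rewrite !mem_cat => /or3P[] h /or3P[] h'.
- exact: d1 h h'.
1,2,3,5,6,7: by case/mapP: h => ? _ [-> _ _] in h'; case/mapP: h' => ? _ [].
- exact: d2 h h'.
- exact: d3 h h'.
Qed.
Definition cond := Prog (f1 (entry P1)) cond_det.

Lemma runs_cond c b c1 b' d :
  runs P1 c b c1 -> runs (if b then P2 else P3) c1 b' d -> runs cond c b' d.
Proof.
have s1 : {subset relocate f1 g1 (code P1) <= code cond}.
  by move=> x /= xP; rewrite mem_cat xP.
have s2 : {subset relocate f2 g2 (code P2) <= code cond}.
  by move=> x /= xP; rewrite !mem_cat xP !orbT.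
have s3 : {subset relocate f3 g3 (code P3) <= code cond}.
  by move=> x /= xP; rewrite !mem_cat xP !orbT.
move=> /(reach_relocate (P' := cond) s1)-/(_ (fun=> erefl))[_ h1].
case: b h1 => h1.
  move=> /(reach_relocate (P' := cond) s2)-/(_ (fun=> erefl))[h2 _].
  exact: (h1 _ _ _ _ (h2 _ _)).
move=> /(reach_relocate (P' := cond) s3)-/(_ (fun=> erefl))[h3 _].
exact: (h1 _ _ _ _ (h3 _ _)).
Qed.
End Cond.

Section Loop.
Variable P : prog.
Let g (x : loc P + bool) : loc P + bool :=
  match x with inl a => inl a | inr true => inl (entry P) | inr false => inr true end.

Fact loop_det : det_code (relocate id g (code P)).
Proof. by apply: det_relocate (@code_det P). Qed.

Definition loop := Prog (entry P) loop_det.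

Lemma runs_loop_stop c d : runs P c false d -> runs loop c true d.
Proof.
have sub : {subset relocate id g (code P) <= code loop} by [].
by move=> /(reach_relocate (P' := loop) sub)-/(_ (fun=> erefl))[h _]; apply: h.
Qed.

Lemma runs_loop_again c c' b d : runs P c true c' -> runs loop c' b d -> runs loop c b d.
Proof.
have sub : {subset relocate id g (code P) <= code loop} by [].
by move=> /(reach_relocate (P' := loop) sub)-/(_ (fun=> erefl))[_ h]; apply: h.
Qed.
End Loop.

Definition andthen P Q := cond P Q Q.

Lemma runs_andthen P Q c b c' b' d :
  runs P c b c' -> runs Q c' b' d -> runs (andthen P Q) c b' d.
Proof. by move=> p q; apply: (runs_cond p); case: b {p}. Qed.

Section Constant.
Variable i0 : 'I_k.

Definition answer b := ask (TChno Sigma X i0 0) b b.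

Lemma runs_answer b c : runs (answer b) c b c.
Proof. by case: c => u alpha; have := runs_ask (TChno Sigma X i0 0) b b u alpha; case: ifP. Qed.

Definition negate P := cond P (answer false) (answer true).

Lemma runs_negate P c b d : runs P c b d -> runs (negate P) c (~~ b) d.
Proof. by move=> p; apply: (runs_cond p); case: b {p}; apply: runs_answer. Qed.

(* Euler tour of the tree with children relation ch and root r, siblings being
   ordered by lt: the programs first, next and up move to the first child, to
   the next sibling and to the parent. The tour stops at a position where found
   succeeds, or else when it is back at the root. *)
Section Tour.
Variables found first next up isroot : prog.

Definition climb := loop (cond isroot (answer false) (cond next (answer false) up)).
Definition advance := cond found (answer false)
  (cond first (answer true) (andthen climb (negate isroot))).
Definition tour := andthen (loop advance) found.

Variables (T : finType) (cfg : T -> heads k t * stack X t) (r : T).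
Variables (ch lt : rel T) (ok : pred T) (h : T -> nat) (F : pred T).
Hypothesis ok_root : ok r.
Hypothesis ok_ch : forall p x, ok p -> ch p x -> ok x.
Hypothesis ch_h : forall p x, ok p -> ch p x -> h x < h p.
Hypothesis ch_root : forall p x, ok p -> ch p x -> x != r.
Hypothesis lt_irr : irreflexive lt.
Hypothesis lt_trans : transitive lt.
Hypothesis lt_total : forall p x y, ok p -> ch p x -> ch p y -> [|| x == y, lt x y | lt y x].
Hypothesis foundP : forall x, ok x -> runs found (cfg x) (F x) (cfg x).
Hypothesis isrootP : forall x, ok x -> runs isroot (cfg x) (x == r) (cfg x).
Hypothesis firstP : forall x, ok x ->
  (exists2 y, ch x y /\ (forall z, ch x z -> ~~ lt z y) & runs first (cfg x) true (cfg y)) \/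
  ((forall y, ~~ ch x y) /\ runs first (cfg x) false (cfg x)).
Hypothesis nextP : forall p x, ok p -> ch p x ->
  (exists2 y, [/\ ch p y, lt x y & forall z, ch p z -> lt x z -> ~~ lt z y]
     & runs next (cfg x) true (cfg y)) \/
  ((forall y, ch p y -> ~~ lt x y) /\ runs next (cfg x) false (cfg x)).
Hypothesis upP : forall p x, ok p -> ch p x -> runs up (cfg x) true (cfg p).

Let continues x c := exists c0 b,
  [/\ runs climb (cfg x) true c0, runs (negate isroot) c0 b c0
    & if b then runs (loop advance) c0 true c else c0 = c].

Let continues_next p x y c : ok p -> ch p x -> ch p y ->
  runs next (cfg x) true (cfg y) -> runs (loop advance) (cfg y) true c ->
  continues x c.
Proof.
move=> okp px py xy yc; exists (cfg y), true.
have okx := ok_ch okp px; have oky := ok_ch okp py; split=> //.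
  apply: runs_loop_stop; apply: (runs_cond (isrootP okx)).
  rewrite (negbTE (ch_root okp px)); apply: (runs_cond xy).
  exact: runs_answer.
have := runs_negate (isrootP oky).
by rewrite (negbTE (ch_root okp py)).
Qed.

Let continues_up p x c : ok p -> ch p x -> runs next (cfg x) false (cfg x) ->
  continues p c -> continues x c.
Proof.
move=> okp px xn [c0 [b [cl rt lp]]]; exists c0, b; split=> //.
apply: (runs_loop_again _ cl); apply: (runs_cond (isrootP (ok_ch okp px))).
rewrite (negbTE (ch_root okp px)); apply: (runs_cond xn).
exact: upP.
Qed.

Let connect_ch x y : connect ch x y -> y = x \/ exists2 z, ch x z & connect ch z y.
Proof.
move=> /connectP[[|z s] /= zs ->]; first by left.
by case/andP: zs => xz zs; right; exists z => //; apply/connectP; exists s.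
Qed.

Let explores x (S : T -> Prop) c1 :=
  (exists2 w, S w & (F w /\ runs (loop advance) c1 true (cfg w))) \/
  ((forall w, S w -> ~~ F w) /\ forall c, continues x c -> runs (loop advance) c1 true c).

Let explore n x : ok x -> h x < n -> explores x (connect ch x) (cfg x).
Proof.
elim: n x => // n IH x okx; rewrite ltnS => hx.
have [Fx|nFx] := boolP (F x).
  left; exists x; first exact: connect0.
  split=> //; apply: runs_loop_stop; apply: (runs_cond (foundP okx)).
  by rewrite Fx; apply: runs_answer.
case: (firstP okx) => [[y [xy ymin] run_y]|[leaf run]]; last first.
  right; split=> [w /connect_ch[->|[z]]//|c [c0 [b [cl rt lp]]]].
    by rewrite (negbTE (leaf z)).
  have adv : runs advance (cfg x) b c0.
    apply: (runs_cond (foundP okx)); rewrite (negbTE nFx).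
    by apply: (runs_cond run); apply: (runs_andthen cl rt).
  case: b rt lp adv => rt lp adv; first exact: (runs_loop_again adv lp).
  by rewrite -lp; apply: runs_loop_stop.
have siblings m z : ch x z -> #|[pred y | ch x y & lt z y]| < m ->
  explores x (fun w => exists2 z', (z' == z) || lt z z' & (ch x z' /\ connect ch z' w))
    (cfg z).
  elim: m z => // m IHm z xz; rewrite ltnS => zm.
  have okz := ok_ch okx xz.
  have [|[w zw [Fw run]]|[nFz skip]] := IH z okz.
  - exact: leq_trans (ch_h okx xz) hx.
  - by left; exists w => //; exists z; rewrite ?eqxx.
  case: (nextP okx xz) => [[z' [xz' zz' minz'] run]|[lastz run]]; last first.
    right; split=> [w [z' /orP[/eqP->|zz'] [xz' z'w]]|c cx].
    - exact: nFz.
    - by have := lastz _ xz'; rewrite zz'.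
    by apply: skip; apply: (continues_up okx xz run cx).
  have [|[w [z2 zz2 z2w] [Fw run']]|[nFw skip']] := IHm z' xz'.
  - apply: leq_trans zm; apply: proper_card; apply/properP; split.
      by apply/subsetP=> y2; rewrite !inE => /andP[-> /(lt_trans zz')].
    by exists z'; rewrite !inE ?lt_irr ?andbF // xz'.
  - left; exists w.
      exists z2 => //; rewrite orbC; case/orP: zz2 => [/eqP->|z'z2]; first by rewrite zz'.
      by rewrite (lt_trans zz' z'z2).
    by split=> //; apply: skip; apply: (continues_next okx xz xz' run).
  right; split=> [w [z2 /orP[/eqP->|zz2] [xz2 z2w]]|c cx]; first exact: nFz.
    apply: nFw; exists z2 => //.
    have := lt_total okx xz2 xz'; rewrite (negbTE (minz' _ xz2 zz2)).
    by rewrite /= eq_sym.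
  by apply: skip; apply: (continues_next okx xz xz' run); apply: skip'.
have adv : runs advance (cfg x) true (cfg y).
  apply: (runs_cond (foundP okx)); rewrite (negbTE nFx).
  by apply: (runs_cond run_y); apply: runs_answer.
case: (siblings _ _ xy (ltnSn _)) => [[w [z _ [xz zw]] [Fw run]]|[nFw skip]].
  left; exists w; first exact: (connect_trans (connect1 xz) zw).
  by split=> //; apply: (runs_loop_again adv run).
right; split=> [w /connect_ch[->//|[z xz zw]]|c /skip]; last exact: (runs_loop_again adv).
apply: nFw; exists z => //; have := lt_total okx xz xy.
by rewrite (negbTE (ymin _ xz)).
Qed.

Lemma runs_tour : exists y,
  [/\ ok y, runs tour (cfg r) (F y) (cfg y), F y = [exists x, connect ch r x && F x]
    & F y || (y == r)].
Proof.
have ok_conn x y : ok x -> connect ch x y -> ok y.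
  move=> okx /connectP[s xs ->]; elim: s x okx xs => //= z s IH x okx.
  by case/andP=> xz; apply: IH; apply: (ok_ch okx xz).
case: (explore ok_root (ltnSn _)) => [[w rw [Fw run]]|[nF skip]].
  exists w; have okw := ok_conn _ _ ok_root rw.
  split=> //; last by rewrite Fw.
    by apply: (runs_andthen run (foundP okw)).
  by rewrite Fw; apply/esym/existsP; exists w; rewrite rw.
exists r; split=> //; last by rewrite eqxx orbT.
  apply: (runs_andthen _ (foundP ok_root)); apply: skip.
  exists (cfg r), false; split=> //.
    apply: runs_loop_stop; apply: (runs_cond (isrootP ok_root)).
    by rewrite eqxx; apply: runs_answer.
  by have := runs_negate (isrootP ok_root); rewrite eqxx.
rewrite (negbTE (nF _ (connect0 _ _))); apply/esym/existsP => -[x /andP[rx]].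
by rewrite (negbTE (nF _ rx)).
Qed.

End Tour.
End Constant.
End Programs.

Section ProgramAutomaton.
Variables (Sigma : finType) (rank : Sigma -> nat) (k : nat) (X : finType).
Variable P : prog Sigma k X.

Definition prog_automaton : ptwa Sigma k :=
  @PTWA Sigma k (loc P + bool)%type X (inl (entry P)) [set inr true]
    (relocate inl id (code P)).

Lemma prog_automaton_det : deterministic prog_automaton.
Proof.
move=> p q1 q2 c1 c2 h1 h2 ne.
have /(_ _ _ _ _ _ h1 h2)[[E1 E2]|//] :
  det_code (relocate (inl : _ -> loc P + bool)%type id (code P)).
  by apply: det_relocate (@code_det _ _ _ P) => a b [].
by rewrite E1 E2 eqxx in ne.
Qed.

Variable t : tree rank.
Local Notation astep := (@step Sigma rank k prog_automaton t).

Lemma exec_fun (chi : op Sigma k X) (c d d' : heads k t * stack X t) :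
  exec chi c d -> exec chi c d' -> d = d'.
Proof.
move=> /execE h /execE; case: chi h => [i|i j|i x|x|tau|tau].
- by case=> j [w [wu ->]] [j' [w' [wu' ->]]]; rewrite (is_child_inj wu wu').
- by case=> w [wu ->] [w' [wu' ->]]; rewrite (is_child_fun wu wu').
- by case=> _ -> [_ ->].
- case: d d' => [u a] [u' a'] /= [w [E ->]] [w' [+ ->]].
  by rewrite E => -[_ ->].
- by case=> _ -> [_ ->].
- by case=> _ -> [_ ->].
Qed.

Lemma halting_exit b c : halting ((inr b, c) : config prog_automaton t).
Proof. by move=> d [chi /mapP[i _ []]]. Qed.

Lemma reach_steps a c b d : reach a c b d ->
  clos_refl_trans _ astep (inl a, c) (inr b, d) /\
  forall e, clos_refl_trans _ astep (inl a, c) e -> halting e -> e = (inr b, d).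
Proof.
have step_in a1 chi q c1 d1 : (a1, chi, q) \in code P -> exec chi c1 d1 ->
    astep (inl a1, c1) (q, d1).
  by move=> h ex; exists chi => //; apply: (relocate_in _ id h).
have step_fun (c1 d1 d2 : config prog_automaton t) :
    astep c1 d1 -> astep c1 d2 -> d1 = d2.
  case: c1 d1 d2 => p c1 [q1 d1] [q2 d2] [chi /= h ex] [chi' /= h' ex'].
  have [[E ->]|[tau [[E E']|[E E']]]] := det_instr prog_automaton_det h h'.
  - by rewrite -E in ex'; rewrite (exec_fun ex ex').
  - by rewrite E E' in ex ex'; case: (execE ex) (execE ex') => /= -> _ [].
  - by rewrite E E' in ex ex'; case: (execE ex') (execE ex) => /= -> _ [].
have first_step c1 d1 e : astep c1 d1 -> clos_refl_trans _ astep c1 e ->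
    halting e -> clos_refl_trans _ astep d1 e.
  move=> cd /clos_rt_rt1n_iff h; case: h cd => [cd /(_ d1)//|y z cy yz cd _].
  by rewrite (step_fun _ _ _ cd cy); apply/clos_rt_rt1n_iff.
elim=> {a c b d} [a c chi b d h ex|a c chi a' c' b d h ex _ [IH IH']].
  split=> [|e ce he]; first by apply: rt_step; apply: (step_in _ _ _ _ _ h ex).
  have /clos_rt_rt1n_iff := first_step _ _ _ (step_in _ _ _ _ _ h ex) ce he.
  by case=> // y z /halting_exit.
have s := step_in _ _ _ _ _ h ex.
split=> [|e ce he]; first exact: (rt_trans _ _ _ _ _ (rt_step _ _ _ _ s) IH).
by apply: IH' => //; apply: (first_step _ _ _ s ce he).
Qed.

Lemma prog_automatonP b :
  runs P (nseq_tuple k (root t), [::]) b (nseq_tuple k (root t), [::]) ->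
  accepts prog_automaton t <-> b.
Proof.
move=> /reach_steps[run uni]; split=> [[p [accp run' halt]]|b1].
  by have [Ep] := uni _ run' halt; move: accp; rewrite Ep inE => /eqP[->].
exists (inr b); split; first by rewrite b1 inE.
  exact: run.
exact: halting_exit.
Qed.

End ProgramAutomaton.

Section Navigation.
Variables (Sigma : finType) (rank : Sigma -> nat) (k : nat) (X : finType).
Variables (i0 : 'I_k).
Local Notation prog := (prog Sigma k X).
Local Notation answer := (@answer Sigma k X i0).

Definition ask_labels (i : 'I_k) (s : seq Sigma) : prog :=
  foldr (fun a p => cond (ask (TLab X i a) true false) (answer true) p) (answer false) s.

Definition ask_rank i j := ask_labels i [seq s <- enum Sigma | j <= rank s].

Definition first_child i := cond (ask_rank i 1) (perform (Down i 1)) (answer false).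

Definition next_sibling_of i j :=
  andthen (perform (Up i))
    (cond (ask_rank i j.+1) (perform (Down i j.+1))
       (andthen (perform (Down i j)) (answer false))).

Definition next_sibling i : prog :=
  foldr (fun j p => cond (ask (TChno Sigma X i j) true false) (next_sibling_of i j) p)
    (answer false) (iota 1 (max_rank rank)).

Definition ask_root i : prog := ask (TChno Sigma X i 0) true false.

Definition head_tour i found :=
  tour i0 found (first_child i) (next_sibling i) (perform (Up i)) (ask_root i).

Definition go_root i := loop (cond (ask_root i) (answer false) (perform (Up i))).

Definition goto i x := head_tour i (ask (TPeb Sigma i x) true false).

Variable t : tree rank.
Implicit Types (u : heads k t) (alpha : stack X t).

Lemma runs_ask_labels i s u alpha :
  runs (ask_labels i s) (u, alpha) (has (fun a => has_label a (tnth u i)) s) (u, alpha).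
Proof.
elim: s => [|a s IH] /=; first exact: runs_answer.
apply: (runs_cond (runs_ask _ _ _ _ _)) => /=.
by case: has_label => //; apply: runs_answer.
Qed.

Lemma runs_ask_rank i j u alpha : 0 < j ->
  runs (ask_rank i j) (u, alpha) [exists w, is_child j (tnth u i) w] (u, alpha).
Proof.
move=> j0; 
have <- : has (fun a => has_label a (tnth u i)) [seq s <- enum Sigma | j <= rank s] =
    [exists w, is_child j (tnth u i) w]; last exact: runs_ask_labels.
apply/esym.
have [s us] := ex_label (tnth u i).
apply/existsP/hasP => [[w uw]|[s']].
  exists s => //; rewrite mem_filter mem_enum andbT.
  by case/andP: (child_rank us uw).
rewrite mem_filter => /andP[js _] us'.
by apply: (ex_child us'); rewrite j0.
Qed.

Lemma runs_up i j u alpha w : is_child j w (tnth u i) ->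
  runs (perform (Up i)) (u, alpha) true (move_head u i w, alpha).
Proof. by move=> wu; apply: runs_perform; apply: ExecUp wu. Qed.

Lemma runs_down i j u alpha w : is_child j (tnth u i) w ->
  runs (perform (Down i j)) (u, alpha) true (move_head u i w, alpha).
Proof. by move=> wu; apply: runs_perform; apply: ExecDown wu. Qed.

Lemma runs_ask_root i u alpha :
  runs (ask_root i) (u, alpha) (tnth u i == root t) (u, alpha).
Proof.
rewrite -child_number_eq0.
by have := runs_ask (TChno Sigma X i 0) true false u alpha => /=; case: (_ == 0).
Qed.

Lemma runs_next_sibling i u alpha p j b d :
  is_child j p (tnth u i) -> runs (next_sibling_of i j) (u, alpha) b d ->
  runs (next_sibling i) (u, alpha) b d.
Proof.
move=> pu run; rewrite /next_sibling.
have : j \in iota 1 (max_rank rank).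
  by rewrite mem_iota (is_child_gt0 pu) add1n ltnS (is_child_max pu).
elim: (iota _ _) => //= j' s IH; rewrite inE => js.
apply: (runs_cond (runs_ask _ _ _ _ _)) => /=; rewrite (is_child_num pu).
by case: eqP js => [<- //|_ /= /IH].
Qed.

Lemma runs_head_tour i found u alpha (F : pred (node t)) :
  tnth u i = root t ->
  (forall w, runs found (move_head u i w, alpha) (F w) (move_head u i w, alpha)) ->
  exists y, [/\ runs (head_tour i found) (u, alpha) (F y) (move_head u i y, alpha),
    F y = [exists w, F w] & F y || (y == root t)].
Proof.
move=> ur foundP.
pose cfg w := (move_head u i w, alpha).
pose ch (p x : node t) := is_child (child_number x) p x.
pose lt (x y : node t) := child_number x < child_number y.
pose B := \max_(w : node t) size (val w).
have head w : tnth (move_head u i w) i = w by rewrite tnth_move eqxx.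
have cfgE w v : (move_head (move_head u i w) i v, alpha) = cfg v by rewrite move_move.
have chE j p x : is_child j p x -> ch p x by move=> px; rewrite /ch (is_child_num px).
have [||||||||||||y [_ run Fy Fr]] := @runs_tour _ _ _ _ t i0 found (first_child i)
  (next_sibling i) (perform (Up i)) (ask_root i) _ cfg (root t) ch lt predT
  (fun x => B - size (val x)) F.
- by [].
- by [].
- move=> p x _ px; rewrite (eqP px) size_rcons.
  have : size (val x) <= B by exact: (leq_bigmax x).
  by rewrite (eqP px) size_rcons => xB; apply: ltn_sub2l.
- by move=> p x _ /child_not_root.
- by move=> x; apply: ltnn.
- by move=> y x z; apply: ltn_trans.
- move=> p x y _ px py; rewrite /lt -neq_ltn orbC.
  have [xy|//] := eqVneq (child_number x) (child_number y).
  by rewrite /ch xy in px; rewrite (is_child_fun px py) eqxx.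
- by move=> x _; apply: foundP.
- by move=> x _; have := runs_ask_root i (move_head u i x) alpha; rewrite head.
- move=> x _; have := @runs_ask_rank i 1 (move_head u i x) alpha isT; rewrite head.
  case: existsP => [[y xy]|leaf] run; [left|right].
    exists y; first split; first exact: chE xy.
      by move=> z /is_child_gt0; rewrite /lt (is_child_num xy) -leqNgt.
    apply: (runs_cond run); rewrite -(cfgE x y); apply: (runs_down (j := 1)).
    by rewrite head.
  split; last by apply: (runs_cond run); apply: runs_answer.
  move=> y; apply/negP => xy; apply: leaf.
  have [s xs] := ex_label x; apply: (ex_child xs).
  by have /andP[y0 /(leq_trans y0)] := child_rank xs xy.
- move=> p x _ px.
  have hpx : is_child (child_number x) p (tnth (move_head u i x) i) by rewrite head.
  have up := runs_up alpha hpx; rewrite move_move in up.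
  have := @runs_ask_rank i (child_number x).+1 (move_head u i p) alpha isT; rewrite head.
  case: existsP => [[y py]|last] run; [left|right].
    exists y; first split.
    + exact: chE py.
    + by rewrite /lt (is_child_num py).
    + by move=> z _; rewrite /lt (is_child_num py) -leqNgt.
    apply: (runs_next_sibling hpx); apply: (runs_andthen up).
    apply: (runs_cond run); rewrite -(cfgE p y); apply: (runs_down (j := (child_number x).+1)).
    by rewrite head.
  split.
    move=> y py; apply/negP => xy; apply: last.
    have [s ps] := ex_label p; apply: (ex_child ps).
    by have /andP[_ /(leq_trans xy)] := child_rank ps py.
  apply: (runs_next_sibling hpx); apply: (runs_andthen up).
  apply: (runs_cond run); rewrite -[X in runs _ _ _ X](cfgE p x).
  apply: (runs_andthen _ (runs_answer _ _ _)).
  by apply: (runs_down (j := child_number x)); rewrite head.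
- move=> p x _ px; rewrite -(cfgE x p); apply: (runs_up (j := child_number x)).
  by rewrite head.
exists y; split=> //; first by move: run; rewrite {1}/cfg -ur move_id.
rewrite Fy; apply: eq_existsb => x; rewrite (_ : connect _ _ _) //.
elim/node_ind: x => [|p x j px rp]; first exact: connect0.
by apply: (connect_trans rp (connect1 _)); apply: chE px.
Qed.

Lemma runs_go_root i u alpha :
  runs (go_root i) (u, alpha) true (move_head u i (root t), alpha).
Proof.
rewrite -{1}(move_id u i); elim/node_ind: (tnth u i) => [|p x j px IH].
  apply: runs_loop_stop; apply: (runs_cond (runs_ask_root _ _ _)).
  by rewrite tnth_move eqxx eqxx; apply: runs_answer.
apply: (runs_loop_again _ IH); apply: (runs_cond (runs_ask_root _ _ _)).
rewrite tnth_move eqxx (negbTE (child_not_root px)).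
rewrite -(move_move u i x p); apply: (runs_up (j := j)).
by rewrite tnth_move eqxx.
Qed.

Lemma mem_stack x v w alpha :
  uniq [seq pn.1 | pn <- alpha] -> (x, w) \in alpha ->
  ((x, v) \in alpha) = (v == w).
Proof.
move=> ua xw; apply/idP/eqP => [xv|-> //].
elim: alpha ua xw xv => //= -[y z] al IH /andP[yal ual].
rewrite !inE => /orP[/eqP xw|xw] /orP[/eqP xv|xv]; last exact: IH.
- by case: xw xv => <- <- [<-].
- by case/negP: yal; case: xw => <- _; apply/mapP; exists (x, v).
- by case/negP: yal; case: xv => <- _; apply/mapP; exists (x, w).
Qed.

Lemma runs_goto i x w u alpha :
  tnth u i = root t -> uniq [seq pn.1 | pn <- alpha] -> (x, w) \in alpha ->
  runs (goto i x) (u, alpha) true (move_head u i w, alpha).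
Proof.
move=> ur ua xw.
have [|y [run ey _]] := runs_head_tour (found := ask (TPeb Sigma i x) true false)
    (u := u) (i := i) (alpha := alpha) (F := pred1 w) ur.
  move=> v; have := runs_ask (TPeb Sigma i x) true false (move_head u i v) alpha.
  by rewrite /= tnth_move eqxx (mem_stack _ ua xw); case: eqP.
have yw : y == w by rewrite [y == w]ey; apply/existsP; exists w; rewrite /= eqxx.
by move: run; rewrite /= yw (eqP yw).
Qed.

End Navigation.

(** * Ordering tuples of nodes *)

Section StrictOrders.

Lemma ex_minimal (T : finType) (lt : rel T) (S : pred T) x :
  irreflexive lt -> transitive lt -> S x ->
  exists2 y, S y & forall z, S z -> ~~ lt z y.
Proof.
move=> irr tr Sx; case: (arg_minnP (fun y => #|[pred z | lt z y]|) Sx) => y Sy ymin.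
exists y => // z Sz; apply/negP => zy.
have := ymin _ Sz; rewrite leqNgt => /negP; apply; apply: proper_card.
apply/properP; split; first by apply/subsetP => w; rewrite !inE => /tr; apply.
by exists z; rewrite !inE ?irr.
Qed.

Fixpoint addr_lt (a b : seq nat) : bool :=
  match a, b with
  | _, [::] => false
  | [::], _ :: _ => true
  | i :: a', j :: b' => (i < j) || (i == j) && addr_lt a' b'
  end.

Lemma addr_lt_irr : irreflexive addr_lt.
Proof. by elim=> //= i a ->; rewrite ltnn eqxx. Qed.

Lemma addr_lt_trans : transitive addr_lt.
Proof.
move=> b a; elim: a b => [|i a IH] [|j b] [|l c] //=.
case/orP=> [ij|/andP[/eqP-> ab]] /orP[jl|/andP[/eqP<- bc]].
- by rewrite (ltn_trans ij jl).
- by rewrite ij.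
- by rewrite jl.
- by rewrite eqxx (IH _ _ ab bc) orbT.
Qed.

Lemma addr_lt_total a b : [|| a == b, addr_lt a b | addr_lt b a].
Proof.
elim: a b => [|i a IH] [|j b] //=; rewrite eqseq_cons.
by case: (ltngtP i j) => //= _; apply: IH.
Qed.

Lemma addr_ltP a b : reflect
  ((prefix a b /\ a <> b) \/
   exists c i j, [/\ i < j, prefix (rcons c i) a & prefix (rcons c j) b])
  (addr_lt a b).
Proof.
apply: (iffP idP).
  elim: a b => [|i a IH] [|j b] //=; first by left.
  case/orP=> [ij|/andP[/eqP<- /IH[[ab ne]|[c [l [m [lm ca cb]]]]]]].
  - by right; exists [::], i, j; rewrite /= !eqxx !prefix0s.
  - by left; rewrite eqxx; split=> // -[].
  - by right; exists (i :: c), l, m; rewrite /= eqxx.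
case=> [[]|[c [i [j [ij]]]]].
  elim: a b => [|i a IH] [|j b] //= /andP[/eqP<- /IH h] ne.
  by rewrite eqxx ltnn h // => ab; apply: ne; rewrite ab.
elim: c a b => [|l c IH] [|i' a] [|j' b] //=.
  by move=> /andP[/eqP<- _] /andP[/eqP<- _]; rewrite ij.
by move=> /andP[/eqP<- ca] /andP[/eqP<- cb]; rewrite eqxx (IH _ _ ca cb) orbT.
Qed.

End StrictOrders.

Section LexOrder.
Variables (Sigma : finType) (rank : Sigma -> nat) (k : nat).
Implicit Type t : tree rank.

Lemma prefix_node t a (u : node t) : prefix a (val u) -> exists w : node t, val w = a.
Proof.
case/prefixP => s; elim/node_ind: u s => [|u w j uw IH] s.
  by case: a => // _; exists (root t).
case/lastP: s => [|s i]; first by rewrite cats0; exists w.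
by rewrite (eqP uw) -rcons_cat => /rcons_inj[/IH].
Qed.

Definition node_lt t (u v : node t) := addr_lt (val u) (val v).

Definition lex t : rel (k.-tuple (node t)) := fun a b =>
  [exists i : 'I_k, node_lt (tnth a i) (tnth b i) &&
     [forall j : 'I_k, (j < i) ==> (tnth a j == tnth b j)]].

Lemma lex_irr t : irreflexive (@lex t).
Proof. by move=> a; apply/existsP => -[i]; rewrite /node_lt addr_lt_irr. Qed.

Lemma lex_trans t : transitive (@lex t).
Proof.
move=> b a c /existsP[i /andP[abi /forallP ab]] /existsP[j /andP[bcj /forallP bc]].
have {}ab (l : 'I_k) : l < i -> tnth a l = tnth b l by move=> li; apply/eqP/(implyP (ab l)).
have {}bc (l : 'I_k) : l < j -> tnth b l = tnth c l by move=> lj; apply/eqP/(implyP (bc l)).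
apply/existsP; case: (ltngtP i j) => [ij|ji|/val_inj ij].
- exists i; rewrite -(bc i) // abi; apply/forallP => l; apply/implyP => li.
  by rewrite ab // bc // (ltn_trans li ij).
- exists j; rewrite (ab j) // bcj; apply/forallP => l; apply/implyP => lj.
  by rewrite ab ?bc // (ltn_trans lj ji).
exists i; rewrite -ij in bcj bc; rewrite /node_lt (addr_lt_trans abi bcj).
by apply/forallP => l; apply/implyP => li; rewrite ab // bc.
Qed.

Lemma lex_total t (a b : k.-tuple (node t)) : [|| a == b, lex a b | lex b a].
Proof.
have [->//|ne] := eqVneq a b.
have [i0 ni0] : exists i, tnth a i != tnth b i.
  apply/existsP; rewrite -negb_forall; apply: contra ne => /forallP h.
  by apply/eqP/eq_from_tnth => i; apply/eqP.
case: (arg_minnP (fun i : 'I_k => i : nat) (P := fun i => tnth a i != tnth b i) ni0).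
move=> i ni imin.
have eq_lt (j : 'I_k) : j < i -> tnth a j = tnth b j.
  by move=> ji; apply/eqP; apply: contraLR ji => /imin; rewrite leqNgt.
have := addr_lt_total (val (tnth a i)) (val (tnth b i)); rewrite val_eqE (negbTE ni) /=.
case/orP=> lti; apply/orP; [left|right]; apply/existsP; exists i; rewrite /node_lt lti.
  by apply/forallP => j; apply/implyP => /eq_lt->.
by apply/forallP => j; apply/implyP => /eq_lt->.
Qed.

Variables (D : forall V, query rank V -> Prop) (DC : fo_class D).

Lemma fo_node_lt V (x y : V) : D (fun t e => node_lt (e x) (e y)).
Proof.
pose M := max_rank rank.
pose branch (i j : nat) : query rank V := fun t e => [exists w, [exists w1, [exists w2,
  [&& is_child i w w1, is_child j w w2, is_ancestor w1 (e x) & is_ancestor w2 (e y)]]]].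
have Dbranch i j : D (branch i j).
  do 3!apply: (fo_ex DC).
  apply: (fo_and DC); first exact: (fo_edg DC i (Some (Some None)) (Some None)).
  apply: (fo_and DC); first exact: (fo_edg DC).
  apply: (fo_and DC); first exact: (fo_le DC (Some None) (Some (Some (Some x)))).
  exact: (fo_le DC None (Some (Some (Some y)))).
have Dfork : D (fun t e => [exists i : 'I_M.+1, [exists j : 'I_M.+1,
    (i < j) && branch i j t e]]).
  apply: (fo_exI DC) => i; apply: (fo_exI DC) => j.
  by apply: (fo_and DC (fo_const DC _ _)); apply: Dbranch.
have Dabove := fo_and DC (fo_le DC x y) (fo_not DC (fo_eq DC x y)).
apply: (fo_ext DC) (fo_or DC Dabove Dfork) => t e.
apply/orP/addr_ltP => [[/andP[xy ne]|]|[[xy ne]|[c [i [j [ij cx cy]]]]]].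
- by left; split=> // /val_inj exy; rewrite exy eqxx in ne.
- case/existsP=> i /existsP[j /andP[ij]].
  case/existsP=> w /existsP[w1 /existsP[w2 /and4P[/eqP ww1 /eqP ww2 w1x w2y]]].
  by right; exists (val w), i, j; rewrite -ww1 -ww2.
- left; apply/andP; split=> //.
  by apply/negP => /eqP exy; apply: ne; rewrite exy.
have [w1 ew1] := prefix_node cx; have [w2 ew2] := prefix_node cy.
have [w ew] : exists w : node t, val w = c.
  by apply: (@prefix_node _ _ w1); rewrite ew1 prefix_rcons.
have ww1 : is_child i w w1 by rewrite /is_child ew ew1.
have ww2 : is_child j w w2 by rewrite /is_child ew ew2.
right; apply/existsP; exists (Ordinal (is_child_max ww1 : i < M.+1)).
apply/existsP; exists (Ordinal (is_child_max ww2 : j < M.+1)); rewrite /= ij.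
apply/existsP; exists w; apply/existsP; exists w1; apply/existsP; exists w2.
by rewrite ww1 ww2 /is_ancestor ew1 ew2 cx.
Qed.

Lemma fo_lex V (f g : 'I_k -> V) : D (fun t e => lex (tup e f) (tup e g)).
Proof.
apply: (fo_exI DC) => i; apply: (fo_and DC).
  by apply: (fo_ext DC) (fo_node_lt (f i) (g i)) => t e; rewrite !tnth_tup.
apply: (fo_allI DC) => j; rewrite /=.
apply: (fo_ext DC) (fo_or DC (fo_const DC _ (~~ (j < i))) (fo_eq DC (f j) (g j))) => t e.
by rewrite !tnth_tup implybE.
Qed.

End LexOrder.

(** * Queries decided by programs *)

Section Checkable.
Variables (Sigma : finType) (rank : Sigma -> nat) (k : nat) (i0 : 'I_k).

Definition top (t : tree rank) : heads k t := nseq_tuple k (root t).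

Lemma tnth_top t i : tnth (top t) i = root t.
Proof. exact: tnth_nseq. Qed.

(* Pebbles are numbered in the order in which they are dropped: d of them may
   be on the stack alpha, and rho z marks the node e z. *)
Definition placed N d V (rho : V -> 'I_N.+1) (t : tree rank) (e : V -> node t)
    (alpha : stack 'I_N.+1 t) :=
  [/\ uniq [seq pn.1 | pn <- alpha],
      forall x : 'I_N.+1, x \in [seq pn.1 | pn <- alpha] -> x < d
    & forall z, (rho z, e z) \in alpha].

(* Here m is the number of additional pebbles that the program may drop. *)
Definition checkable V (P : query rank V) :=
  exists m, forall N d (rho : V -> 'I_N.+1), d + m <= N ->
  exists p : prog Sigma k 'I_N.+1, forall (t : tree rank) e alpha,
    placed d rho e alpha -> runs p (top t, alpha) (P t e) (top t, alpha).

Section Primitives.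
Variables (N : nat) (t : tree rank).
Local Notation X := 'I_N.+1.
Implicit Types (alpha : stack X t) (u : heads k t).

Lemma placed_push d V (rho : V -> X) (e : V -> node t) alpha w :
  d <= N -> placed d rho e alpha ->
  placed d.+1 (fun o => if o is Some z then rho z else inord d)
    (fun o => if o is Some z then e z else w) ((inord d, w) :: alpha).
Proof.
move=> dN [ua lta ra]; have dE : @inord N d = d :> nat by rewrite inordK.
split=> /=.
- by rewrite ua andbT; apply/negP => /lta; rewrite dE ltnn.
- by move=> x; rewrite inE => /orP[/eqP->|/lta /ltnW]; rewrite ?dE.
- by case=> [z|]; rewrite inE ?eqxx // ra orbT.
Qed.

Lemma placed_drop d V (rho : V -> X) (e : V -> node t) alpha i u :
  d <= N -> placed d rho e alpha ->
  runs (perform (Drop i (inord d))) (u, alpha) true (u, (inord d, tnth u i) :: alpha).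
Proof.
move=> dN [_ lta _]; apply: runs_perform; apply: ExecDrop.
by apply/negP => /lta; rewrite inordK // ltnn.
Qed.

Lemma runs_retrieve x w u alpha :
  runs (perform (Retrieve x)) (u, (x, w) :: alpha) true (u, alpha).
Proof. by apply: runs_perform; apply: ExecRetrieve. Qed.

Lemma placed_goto d V (rho : V -> X) (e : V -> node t) alpha i z u :
  tnth u i = root t -> placed d rho e alpha ->
  runs (goto rank i0 i (rho z)) (u, alpha) true (move_head u i (e z), alpha).
Proof. by move=> ui [ua _ ra]; apply: runs_goto. Qed.

Definition pebs d n (f : 'I_n -> node t) : stack X t :=
  rev [seq (inord (d + i), f i) | i : 'I_n <- enum 'I_n].

Definition peb_names d n : seq X := rev [seq inord (d + i) | i : 'I_n <- enum 'I_n].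

Lemma names_pebs d n (f : 'I_n -> node t) : [seq pn.1 | pn <- pebs d f] = peb_names d n.
Proof. by rewrite /pebs map_rev -map_comp. Qed.

Lemma pebs0 d (f : 'I_0 -> node t) : pebs d f = [::].
Proof. by rewrite /pebs enum_ord0. Qed.

Lemma pebsS d n (f : 'I_n.+1 -> node t) alpha :
  pebs d f ++ alpha = pebs d.+1 (fun i => f (lift ord0 i)) ++ (inord d, f ord0) :: alpha.
Proof.
rewrite /pebs enum_ordSl /= rev_cons cat_rcons -map_comp addn0; congr (rev _ ++ _).
by apply: eq_map => i /=; rewrite addSnnS.
Qed.

Lemma placed_pebs d n V (rho : V -> X) (e : V -> node t) (f : 'I_n -> node t) alpha :
  d + n <= N -> placed d rho e alpha ->
  placed (d + n) (fun z : V + 'I_n => match z with inl z => rho z | inr i => inord (d + i) end)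
    (fun z => match z with inl z => e z | inr i => f i end) (pebs d f ++ alpha).
Proof.
move=> dN [ua lta ra].
have iE (i : 'I_n) : @inord N (d + i) = d + i :> nat.
  by rewrite inordK // ltnS (leq_trans _ dN) // leq_add2l ltnW.
have nameP x : x \in peb_names d n -> d <= x < d + n.
  by rewrite mem_rev => /mapP[i _ ->]; rewrite iE leq_addr ltn_add2l ltn_ord.
split.
- rewrite map_cat names_pebs cat_uniq ua andbT; apply/andP; split.
    rewrite rev_uniq map_inj_uniq ?enum_uniq // => i j /(congr1 val).
    by rewrite /= !iE => /addnI /val_inj.
  apply/hasPn => x /lta xd; apply/negP => /nameP/andP[dx _].
  by rewrite leqNgt xd in dx.
- move=> x; rewrite map_cat names_pebs mem_cat => /orP[/nameP/andP[]//|/lta xd].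
  exact: leq_trans xd (leq_addr _ _).
case=> [z|i]; first by rewrite mem_cat ra orbT.
by rewrite mem_cat mem_rev; apply/orP; left; apply/mapP; exists i; rewrite ?mem_enum.
Qed.

Definition retrieve_all (s : seq X) : prog Sigma k X :=
  foldr (fun x p => andthen (perform (Retrieve x)) p) (answer _ _ i0 true) s.

Lemma runs_retrieve_all beta u alpha :
  runs (retrieve_all [seq pn.1 | pn <- beta]) (u, beta ++ alpha) true (u, alpha).
Proof.
elim: beta => [|[x w] beta IH] /=; first exact: runs_answer.
exact: runs_andthen (runs_retrieve _ _ _ _) IH.
Qed.

Definition drop_all d (s : seq 'I_k) : prog Sigma k X :=
  foldr (fun i p => andthen (perform (Drop i (inord (d + i)))) p) (answer _ _ i0 true) s.

Lemma runs_drop_all d V (rho : V -> X) (e : V -> node t) alpha u :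
  d + k <= N -> placed d rho e alpha ->
  runs (drop_all d (enum 'I_k)) (u, alpha) true (u, pebs d (tnth u) ++ alpha).
Proof.
move=> dN /(placed_pebs (tnth u) dN)[]; rewrite /pebs => + _ _.
elim: (enum 'I_k) alpha => [|i s IH] alpha /=; first by move=> _; apply: runs_answer.
rewrite rev_cons cat_rcons => ua.
apply: (runs_andthen _ (IH _ ua)); apply: runs_perform; apply: ExecDrop.
by move: ua; rewrite map_cat cat_uniq => /and3P[_ _ /= /andP[]].
Qed.

Definition all_heads (q : 'I_k -> prog Sigma k X) : prog Sigma k X :=
  foldr (fun i p => andthen (q i) p) (answer _ _ i0 true) (enum 'I_k).

Lemma runs_all_heads q (a b : heads k t) alpha :
  (forall u i, tnth u i = tnth a i ->
     runs (q i) (u, alpha) true (move_head u i (tnth b i), alpha)) ->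
  runs (all_heads q) (a, alpha) true (b, alpha).
Proof.
move=> runq; rewrite /all_heads.
suff gen s u : uniq s -> (forall i, tnth u i = if i \in s then tnth a i else tnth b i) ->
    runs (foldr (fun i p => andthen (q i) p) (answer _ _ i0 true) s) (u, alpha) true (b, alpha).
  by apply: gen => [|i]; rewrite ?enum_uniq // mem_enum.
elim: s u => [|i s IH] u /=.
  by move=> _ ub; have -> : u = b; [apply: eq_from_tnth|apply: runs_answer].
case/andP=> nis us ua; apply: (runs_andthen (runq _ _ _)); first by rewrite ua inE eqxx.
apply: IH => // j; rewrite tnth_move ua inE.
by case: eqP => [->|//]; rewrite (negbTE nis).
Qed.

Definition root_all := all_heads (fun i => go_root Sigma X i0 i).

Lemma runs_root_all u alpha : runs root_all (u, alpha) true (top t, alpha).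
Proof. by apply: runs_all_heads => u' i _; rewrite tnth_top; apply: runs_go_root. Qed.

End Primitives.

Lemma checkable_and V (P P' : query rank V) :
  checkable P -> checkable P' -> checkable (fun t e => P t e && P' t e).
Proof.
case=> m hP [m' hP']; exists (m + m') => N d rho dN.
have [|p hp] := hP N d rho.
  by apply: leq_trans dN; rewrite leq_add2l leq_addr.
have [|p' hp'] := hP' N d rho.
  by apply: leq_trans dN; rewrite leq_add2l leq_addl.
exists (cond p p' (answer _ _ i0 false)) => t e alpha pl.
apply: (runs_cond (hp _ _ _ pl)); case: (P t e) => /=; first exact: hp'.
exact: runs_answer.
Qed.

Lemma search V (Q : forall t, (V -> node t) -> node t -> bool) :
  checkable (fun t (e : option V -> node t) => Q t (fun z => e (Some z)) (e None)) ->
  exists m, forall N d (rho : V -> 'I_N.+1), d + m <= N ->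
  exists p : prog Sigma k 'I_N.+1, forall (t : tree rank) e alpha,
    placed d rho e alpha -> exists y,
    runs p (top t, alpha) (Q t e y) (move_head (top t) i0 y, alpha) /\
    Q t e y = [exists u, Q t e u].
Proof.
case=> m hQ; exists m.+1 => N d rho dN.
have [|p hp] := hQ N d.+1 (fun o => if o is Some z then rho z else inord d).
  by rewrite addSnnS.
have {}dN : d <= N by apply: leq_trans dN; rewrite leq_addr.
pose back b := andthen (goto rank i0 i0 (inord d : 'I_N.+1))
  (andthen (perform (Retrieve (inord d))) (answer _ _ i0 b)).
exists (head_tour rank i0 i0 (andthen (perform (Drop i0 (inord d)))
  (andthen (go_root _ _ i0 i0) (cond p (back true) (back false))))) => t e alpha pl.
have [||y [run ey _]] := @runs_head_tour _ _ _ _ i0 t i0 (andthen (perform (Drop i0 (inord d)))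
  (andthen (go_root _ _ i0 i0) (cond p (back true) (back false)))) (top t) alpha (Q t e).
- exact: tnth_top.
- move=> w; apply: (runs_andthen (placed_drop _ _ dN pl)).
  have pl' := placed_push w dN pl.
  have hw : move_head (move_head (top t) i0 w) i0 (root t) = top t.
    by rewrite move_move -[X in move_head _ _ X](tnth_top t i0) move_id.
  rewrite tnth_move eqxx.
  have := runs_go_root i0 i0 (move_head (top t) i0 w) ((inord d, w) :: alpha).
  rewrite hw => rt; apply: (runs_andthen rt); apply: (runs_cond (hp _ _ _ pl')).
  have gt := placed_goto None (tnth_top t i0) pl'.
  by case: (Q t e w); rewrite /back; apply: (runs_andthen gt);
     apply: (runs_andthen (runs_retrieve _ _ _ _)); apply: runs_answer.
by exists y.
Qed.

Lemma checkable_not V (P : query rank V) : checkable P -> checkable (fun t e => ~~ P t e).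
Proof.
case=> m hP; exists m => N d rho /(hP N d rho)[p hp]; exists (negate i0 p).
by move=> t e alpha pl; apply: runs_negate; apply: hp.
Qed.

Lemma checkable_ex V (Q : forall t, (V -> node t) -> node t -> bool) :
  checkable (fun t (e : option V -> node t) => Q t (fun z => e (Some z)) (e None)) ->
  checkable (fun t e => [exists u, Q t e u]).
Proof.
move=> /search[m hQ]; exists m => N d rho /(hQ N d rho)[p hp].
exists (cond p (andthen (root_all N) (answer _ _ i0 true))
  (andthen (root_all N) (answer _ _ i0 false))).
move=> t e alpha /hp[y [run <-]]; apply: (runs_cond run).
by case: (Q t e y); apply: (runs_andthen (runs_root_all _ _)); apply: runs_answer.
Qed.

Lemma checkable_at V (x : V) (P : query rank V) :
  (forall N (rho : V -> 'I_N.+1), exists p, forall t e alpha d,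
     placed d rho e alpha -> exists u,
     runs p (move_head (top t) i0 (e x), alpha) (P t e) (u, alpha)) ->
  checkable P.
Proof.
move=> hP; exists 0 => N d rho _; have [p hp] := hP N rho.
exists (andthen (goto rank i0 i0 (rho x)) (cond p (andthen (root_all N) (answer _ _ i0 true))
  (andthen (root_all N) (answer _ _ i0 false)))) => t e alpha pl.
apply: (runs_andthen (placed_goto x (tnth_top t i0) pl)).
have [u run] := hp t e alpha d pl; apply: (runs_cond run).
by case: (P t e); apply: (runs_andthen (runs_root_all _ _)); apply: runs_answer.
Qed.

Lemma placed_mem N d V (rho : V -> 'I_N.+1) t e alpha z v :
  @placed N d V rho t e alpha -> ((rho z, v) \in alpha) = (v == e z).
Proof. by case=> ua _ ra; apply: mem_stack. Qed.

Lemma placed_ask N d V (rho : V -> 'I_N.+1) t e alpha (u : heads k t) z :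
  placed d rho e alpha ->
  runs (ask (TPeb Sigma i0 (rho z)) true false) (u, alpha) (tnth u i0 == e z) (u, alpha).
Proof.
move=> pl; have := runs_ask (TPeb Sigma i0 (rho z)) true false u alpha.
by rewrite /= (placed_mem _ _ pl); case: eqP.
Qed.

Lemma prefix_rcons_r (T : eqType) (a b : seq T) j :
  prefix a (rcons b j) = prefix a b || (a == rcons b j).
Proof.
elim: b a => [|c b IH] [|x a] //=.
by rewrite eqseq_cons IH; case: (x == c).
Qed.

Lemma checkable_class : fo_class checkable.
Proof.
split.
- move=> V W g P [m hP]; exists m => N d rho /(hP N d (fun z => rho (g z)))[p hp].
  by exists p => t e alpha [ua la ra]; apply: hp.
- move=> V P P' PP [m hP]; exists m => N d rho /(hP N d rho)[p hp].
  by exists p => t e alpha; rewrite -PP; apply: hp.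
- exact: checkable_not.
- exact: checkable_and.
- exact: checkable_ex.
- move=> V s x; apply: (@checkable_at _ x) => N rho.
  exists (ask (TLab _ i0 s) true false) => t e alpha d pl.
  exists (move_head (top t) i0 (e x)).
  have := runs_ask (TLab 'I_N.+1 i0 s) true false (move_head (top t) i0 (e x)) alpha.
  by rewrite /= tnth_move eqxx; case: has_label.
- move=> V i x y; apply: (@checkable_at _ y) => N rho.
  exists (cond (ask_root Sigma _ i0) (answer _ _ i0 false)
    (cond (ask (TChno _ _ i0 i) true false)
       (andthen (perform (Up i0)) (ask (TPeb Sigma i0 (rho x)) true false))
       (answer _ _ i0 false))) => t e alpha d pl.
  set u := move_head (top t) i0 (e y).
  have uy : tnth u i0 = e y by rewrite tnth_move eqxx.
  have := runs_ask_root i0 u alpha; rewrite uy; have [y0|ny] := eqVneq (e y) (root t) => r.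
    exists u; apply: (runs_cond r).
    have -> : is_child i (e x) (e y) = false; last exact: runs_answer.
    by apply/negP => /child_not_root; rewrite y0 eqxx.
  have c := runs_ask (TChno Sigma 'I_N.+1 i0 i) true false u alpha.
  rewrite /= uy in c; have [yi|nyi] := eqVneq (child_number (e y)) i; last first.
    exists u; apply: (runs_cond r); apply: (runs_cond c); rewrite (negbTE nyi).
    have -> : is_child i (e x) (e y) = false; last exact: runs_answer.
    by apply/negP => /is_child_num/eqP; rewrite (negbTE nyi).
  have [w wy] := ex_parent ny; rewrite yi eqxx in wy c.
  exists (move_head u i0 w); apply: (runs_cond r); apply: (runs_cond c).
  have wu : is_child i w (tnth u i0) by rewrite uy.
  apply: (runs_andthen (runs_up alpha wu)).
  have -> : is_child i (e x) (e y) = (tnth (move_head u i0 w) i0 == e x).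
    rewrite tnth_move eqxx; apply/idP/eqP => [xy|<-//].
    exact: is_child_inj wy xy.
  exact: placed_ask pl.
- move=> V x y; apply: (@checkable_at _ y) => N rho.
  pose peb b b' : prog Sigma k 'I_N.+1 := ask (TPeb Sigma i0 (rho x)) b b'.
  exists (andthen (loop (cond (peb true false) (answer _ _ i0 false)
    (cond (ask_root Sigma _ i0) (answer _ _ i0 false) (perform (Up i0))))) (peb true false)).
  move=> t e alpha d pl.
  have pebP b b' v : runs (peb b b') (move_head (top t) i0 v, alpha)
      (if v == e x then b else b') (move_head (top t) i0 v, alpha).
    have := runs_ask (TPeb Sigma i0 (rho x)) b b' (move_head (top t) i0 v) alpha.
    have := placed_mem x v pl; rewrite /= tnth_move eqxx => ->.
    by case: eqP.
  have rootP v := runs_ask_root i0 (move_head (top t) i0 v) alpha.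
  suff [v [run ->]] : exists v, runs (loop (cond (peb true false) (answer _ _ i0 false)
      (cond (ask_root Sigma _ i0) (answer _ _ i0 false) (perform (Up i0)))))
      (move_head (top t) i0 (e y), alpha) true (move_head (top t) i0 v, alpha) /\
      is_ancestor (e x) (e y) = (v == e x).
    exists (move_head (top t) i0 v); apply: (runs_andthen run).
    by have := pebP true false v; case: eqP.
  elim/node_ind: (e y) => [|w v j wv [v' [run anc]]].
    exists (root t); split; last first.
      by rewrite -[LHS]/(prefix (val (e x)) [::]) prefixs0 -[RHS]val_eqE eq_sym.
    apply: runs_loop_stop; apply: (runs_cond (pebP _ _ _)).
    case: eqP => _; first exact: runs_answer.
    apply: (runs_cond (rootP _)); rewrite tnth_move eqxx eqxx; exact: runs_answer.
  have ancE : is_ancestor (e x) v = is_ancestor (e x) w || (v == e x).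
    rewrite /is_ancestor -[v == e x]val_eqE /= (eqP wv) prefix_rcons_r.
    by rewrite [rcons _ _ == _]eq_sym.
  have [vx|nvx] := eqVneq v (e x).
    exists v; rewrite ancE vx eqxx orbT; split=> //.
    apply: runs_loop_stop; apply: (runs_cond (pebP _ _ _)).
    by rewrite eqxx; apply: runs_answer.
  exists v'; rewrite ancE (negbTE nvx) orbF; split=> //.
  apply: (runs_loop_again _ run); apply: (runs_cond (pebP _ _ _)).
  rewrite (negbTE nvx); apply: (runs_cond (rootP _)).
  rewrite tnth_move eqxx (negbTE (child_not_root wv)) -(move_move (top t) i0 v w).
  by apply: (runs_up (j := j)); rewrite tnth_move eqxx.
move=> V x y; apply: (@checkable_at _ y) => N rho.
exists (ask (TPeb Sigma i0 (rho x)) true false) => t e alpha d pl.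
exists (move_head (top t) i0 (e y)).
by have := placed_ask (move_head (top t) i0 (e y)) x pl; rewrite tnth_move eqxx eq_sym.
Qed.
End Checkable.

(** * Transitive closure of functional relations *)

Section CheckableDTC.
Variables (Sigma : finType) (rank : Sigma -> nat) (k : nat) (i0 : 'I_k).
Local Notation checkable := (@checkable Sigma rank k).
Local Notation yes := (answer _ _ i0 true).
Local Notation no := (answer _ _ i0 false).
Let CC := checkable_class rank i0.

Lemma witness n V (Q : forall t, (V -> node t) -> ('I_n -> node t) -> bool) :
  checkable (fun t (e : V + 'I_n -> node t) =>
    Q t (fun z => e (inl z)) (fun i => e (inr i))) ->
  exists m, forall N d (rho : V -> 'I_N.+1), d + m <= N ->
  exists p : prog Sigma k 'I_N.+1, forall (t : tree rank) e alpha,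
    placed d rho e alpha -> [exists f : {ffun 'I_n -> node t}, Q t e f] ->
    exists f, Q t e f /\
      runs p (top k t, alpha) true (top k t, pebs N d f ++ alpha).
Proof.
elim: n V Q => [|n IH] V Q hQ.
  exists 0 => N d rho _; exists yes => t e alpha _ /existsP[f Qf].
  by exists f; split=> //; rewrite pebs0; apply: runs_answer.
pose Q1 t e u := [exists f : {ffun 'I_n -> node t}, Q t e (fcons u f)].
pose Q2 t (e : option V -> node t) f := Q t (fun z => e (Some z)) (fcons (e None) f).
have hQ2 := fo_fcons CC hQ.
have [m1 h1] := search i0 (Q := Q1) (fo_ex_ffun CC (Q := Q2) hQ2).
have [m2 h2] := IH _ Q2 hQ2.
exists (m1 + m2).+1 => N d rho dN.
have [|p1 hp1] := h1 N d rho.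
  by apply: leq_trans dN; rewrite leq_add2l leqW // leq_addr.
have [|p2 hp2] := h2 N d.+1 (fun o => if o is Some z then rho z else inord d).
  by apply: leq_trans dN; rewrite addSnnS leq_add2l ltnS leq_addl.
have {}dN : d <= N by apply: leq_trans dN; rewrite leq_addr.
exists (andthen p1 (andthen (perform (Drop i0 (inord d)))
  (andthen (go_root _ _ i0 i0) p2))) => t e alpha pl ex.
have [u [run Qu]] := hp1 t e alpha pl.
have {}Qu : Q1 t e u.
  rewrite Qu; case/existsP: ex => f Qf; apply/existsP; exists (f ord0).
  by apply/existsP; exists [ffun i => f (lift ord0 i)]; rewrite fcons_eta.
have pl' := placed_push u dN pl.
have [f [Qf run2]] := hp2 t _ _ pl' Qu.
exists (fcons u f); split=> //; apply: (runs_andthen run).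
apply: (runs_andthen (placed_drop _ _ dN pl)); rewrite tnth_move eqxx.
apply: (runs_andthen (runs_go_root _ _ _ _)).
rewrite move_move -[X in move_head _ _ X](tnth_top t i0) move_id.
rewrite pebsS; move: run2; congr (runs _ _ _ (_, pebs N _ _ ++ (_, _) :: _)).
  by apply: functional_extensionality => i; rewrite /fcons liftK.
by rewrite /fcons unlift_none.
Qed.

Lemma move_tuple V (R : brel rank k V) :
  checkable (rel_query R) ->
  exists m, forall N d (rho : V -> 'I_N.+1), d + m <= N ->
  exists p : prog Sigma k 'I_N.+1, forall (t : tree rank) e alpha,
    placed d rho e alpha -> forall x : k.-tuple (node t),
    (exists2 y, R t e x y & runs p (top k t, pebs N d (tnth x) ++ alpha) true
                                 (top k t, pebs N d (tnth y) ++ alpha)) \/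
    ((forall y, ~~ R t e x y) /\ runs p (top k t, pebs N d (tnth x) ++ alpha) false
                                 (top k t, pebs N d (tnth x) ++ alpha)).
Proof.
move=> hR.
pose Q t (e : V + 'I_k -> node t) f := R t (fun z => e (inl z)) (tup e inr) (tup f id).
have [m1 h1] : checkable (fun t (e : V + 'I_k -> node t) =>
    [exists f : {ffun 'I_k -> node t}, Q t e f]) by apply: (fo_ex_ffun CC); exact: hR.
have [m2 h2] := witness (Q := Q) hR.
exists (k + (k + (m1 + m2))) => N d rho dN.
have dkk : d + k + k <= N by apply: leq_trans dN; rewrite -addnA !leq_add2l leq_addr.
have dk : d + k <= N by apply: leq_trans dkk; rewrite leq_addr.
pose rho' (z : V + 'I_k) : 'I_N.+1 :=
  match z with inl z => rho z | inr i => inord (d + i) end.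
have [|p1 hp1] := h1 N (d + k) rho'.
  by apply: leq_trans dN; rewrite -addnA !leq_add2l (leq_trans (leq_addr m2 m1)) ?leq_addl.
have [|p2 hp2] := h2 N (d + k) rho'.
  by apply: leq_trans dN; rewrite -addnA !leq_add2l addnA leq_addl.
exists (cond p1 (andthen p2
  (andthen (all_heads i0 (fun i => goto rank i0 i (inord (d + k + i))))
  (andthen (retrieve_all Sigma i0 (peb_names N (d + k) k))
  (andthen (retrieve_all Sigma i0 (peb_names N d k))
  (andthen (drop_all Sigma i0 N d (enum 'I_k)) (andthen (root_all Sigma i0 N) yes)))))) no).
move=> t e alpha pl x.
have plx := placed_pebs (tnth x) dk pl.
pose ex (z : V + 'I_k) := match z with inl z => e z | inr i => tnth x i end.
have QE f : Q t ex f = R t e x (tup f id).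
  by rewrite /Q (_ : tup ex inr = x) //; apply: tup_tnth.
have check := hp1 t _ _ plx.
case E: [exists f : {ffun 'I_k -> node t}, Q t ex f] in check; [left|right]; last first.
  split; last by apply: (runs_cond check); apply: runs_answer.
  move=> y; apply/negP => xy; move/negbT/negP: E; apply; apply/existsP.
  exists [ffun i => tnth y i]; rewrite QE (_ : tup _ _ = y) //.
  by apply: tup_tnth => i; rewrite ffunE.
have [f [Qf run2]] := hp2 t _ _ plx E.
exists (tup f id); first by rewrite -QE.
apply: (runs_cond check); apply: (runs_andthen run2).
have ply := placed_pebs f dkk plx.
apply: (runs_andthen (b := true)
  (c' := (tup f id, pebs N (d + k) f ++ pebs N d (tnth x) ++ alpha))).
  apply: runs_all_heads => u i; rewrite tnth_top tnth_tup => ui.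
  exact: (placed_goto i0 (inr i) ui ply).
rewrite -(names_pebs N (d + k) f); apply: (runs_andthen (runs_retrieve_all i0 _ _ _)).
rewrite -(names_pebs N d (tnth x)); apply: (runs_andthen (runs_retrieve_all i0 _ _ _)).
apply: (runs_andthen (runs_drop_all i0 _ dk pl)).
exact: runs_andthen (runs_root_all _ _ _) (runs_answer _ _ _).
Qed.

(* Once the edges leaving v are removed from a functional relation, the tuples
   that reach v form a tree with root v, whose parent map is the relation. It is
   explored by an Euler tour, which terminates, in search of u. *)
Lemma checkable_dtc : dtc_closed k checkable.
Proof.
move=> V R funR hR.
pose W := (V + 'I_k + 'I_k)%type.
pose E : brel rank k W := fun t e x y => R t (fun z => e (inl (inl z))) x y && (x != tup e inr).
pose sib : brel rank k W := fun t e x y => [exists p, E t e x p && E t e y p].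
pose first : brel rank k W := fun t e x y =>
  E t e y x && ~~ [exists z, E t e z x && lex z y].
pose next : brel rank k W := fun t e x y =>
  [&& sib t e x y, lex x y & ~~ [exists z, [&& sib t e x z, lex x z & lex z y]]].
have hE : checkable (rel_query E).
  apply: (fo_and CC).
    exact: (fo_rel_sub CC (fun z => inl (inl (inl (inl z)))) (fun i => inl (inr i)) inr hR).
  exact: (fo_not CC (fo_eqt CC (fun i => inl (inr i)) (fun i => inl (inl (inr i))))).
have hsib : checkable (rel_query sib).
  apply: (fo_ex_tup CC); apply: (fo_and CC).
    exact: (fo_rel_sub CC (fun z => inl (inl (inl z))) (fun i => inl (inl (inr i))) inr hE).
  exact: (fo_rel_sub CC (fun z => inl (inl (inl z))) (fun i => inl (inr i)) inr hE).
have hfirst : checkable (rel_query first).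
  apply: (fo_and CC).
    exact: (fo_rel_sub CC (fun z => inl (inl z)) inr (fun i => inl (inr i)) hE).
  apply: (fo_not CC); apply: (fo_ex_tup CC); apply: (fo_and CC).
    exact: (fo_rel_sub CC (fun z => inl (inl (inl z))) inr (fun i => inl (inl (inr i))) hE).
  exact: (fo_lex CC inr (fun i => inl (inr i))).
have hnext : checkable (rel_query next).
  apply: (fo_and CC); first exact: hsib.
  apply: (fo_and CC); first exact: (fo_lex CC (fun i => inl (inr i)) inr).
  apply: (fo_not CC); apply: (fo_ex_tup CC); apply: (fo_and CC).
    exact: (fo_rel_sub CC (fun z => inl (inl (inl z))) (fun i => inl (inl (inr i))) inr hsib).
  apply: (fo_and CC); first exact: (fo_lex CC (fun i => inl (inl (inr i))) inr).
  exact: (fo_lex CC inr (fun i => inl (inr i))).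
have [mc hc] : checkable (fun t (e : W + 'I_k -> node t) =>
    tup e inr == tup e (fun i => inl (inl (inr i)))) by apply: (fo_eqt CC).
have [mr hr] : checkable (fun t (e : W + 'I_k -> node t) =>
    tup e inr == tup e (fun i => inl (inr i))) by apply: (fo_eqt CC).
have [mf hf] := move_tuple hfirst; have [mn hn] := move_tuple hnext.
have [mu hu] := move_tuple hE.
exists (k + (mc + mr + mf + mn + mu)) => N d rho; set M := (_ + mu) => dN.
have dk : d + k <= N by apply: leq_trans dN; rewrite leq_add2l leq_addr.
have bound a : a <= M -> d + k + a <= N.
  by move=> aM; apply: leq_trans dN; rewrite -addnA !leq_add2l.
have bound' a : a <= M -> d + a <= N.
  by move=> /bound; apply: leq_trans; rewrite leq_add2r leq_addr.
pose rho' (z : W + 'I_k) : 'I_N.+1 :=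
  match z with inl z => rho z | inr i => inord (d + i) end.
have [|pc hpc] := hc N (d + k) rho' (bound _ _).
  by rewrite /M -!addnA leq_addr.
have [|pr hpr] := hr N (d + k) rho' (bound _ _).
  by rewrite /M -!addnA addnCA leq_addr.
have [|pf hpf] := hf N d rho (bound' _ _).
  by rewrite /M [_ + mf]addnC -!addnA leq_addr.
have [|pn hpn] := hn N d rho (bound' _ _).
  by rewrite /M [_ + mn]addnC -!addnA leq_addr.
have [|pu hpu] := hu N d rho (bound' _ _); first by rewrite leq_addl.
pose found := tour i0 pc pf pn pu pr.
exists (andthen (all_heads i0 (fun i => goto rank i0 i (rho (inr i))))
  (andthen (drop_all Sigma i0 N d (enum 'I_k)) (andthen (root_all Sigma i0 N)
  (cond found (andthen (retrieve_all Sigma i0 (peb_names N d k)) yes)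
              (andthen (retrieve_all Sigma i0 (peb_names N d k)) no))))) => t e alpha pl.
pose u := tup e (fun i => inl (inr i)); pose v := tup e inr.
pose cfg (x : k.-tuple (node t)) := (top k t, pebs N d (tnth x) ++ alpha).
apply: (runs_andthen (c' := (v, alpha)) (b := true)).
  apply: runs_all_heads => w i; rewrite tnth_top tnth_tup => wi.
  exact: (placed_goto i0 (inr i) wi pl).
apply: (runs_andthen (runs_drop_all i0 _ dk pl)).
apply: (runs_andthen (runs_root_all i0 _ _)).
pose Ev := E t e; pose Rv := R t (fun z => e (inl (inl z))).
have funE x p p' : Ev x p -> Ev x p' -> p = p'.
  by case/andP=> xp _ /andP[xp' _]; exact: (funR _ _ _ _ _ xp xp').
have stuck p : ~~ Ev v p by rewrite /Ev /E eqxx andbF.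
have acyclic x p : connect Ev x v -> Ev x p -> ~~ connect Ev p x.
  move=> xv xp; apply/negP => px.
  have back y : connect Ev x y -> connect Ev y x.
    move=> /connectP[s xs ->]; elim/last_ind: s xs => [|s z IH] /=.
      by rewrite connect0.
    rewrite rcons_path last_rcons => /andP[/IH lx lz].
    case/connectP: lx => -[|z' s'] /= path_s Es.
      by rewrite -Es in lz; rewrite (funE _ _ _ lz xp).
    case/andP: path_s => lz' zs'; apply/connectP; exists s' => //.
      by rewrite (funE _ _ _ lz lz').
    by rewrite (funE _ _ _ lz lz').
  case/connectP: (back _ xv) => -[|z s] /= path_s Es.
    by move: xp; rewrite Es (negbTE (stuck _)).
  by move: path_s; rewrite (negbTE (stuck _)).
have plX x := placed_pebs (tnth x) dk pl.
have tupX (x : k.-tuple (node t)) :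
    tup (fun z : W + 'I_k => match z with inl z => e z | inr i => tnth x i end) inr = x.
  exact: tup_tnth.
have runc x : runs pc (cfg x) (x == u) (cfg x).
  by have := hpc t _ _ (plX x); rewrite tupX.
have runr x : runs pr (cfg x) (x == v) (cfg x).
  by have := hpr t _ _ (plX x); rewrite tupX.
have sibE p x y : Ev x p -> sib t e x y = Ev y p.
  move=> xp; apply/existsP/idP => [[p' /andP[xp' yp']]|yp].
    by rewrite (funE _ _ _ xp xp').
  by exists p; apply/andP; split.
have [||||||||||||y [_ run Fy Fr]] := @runs_tour _ _ _ _ t i0 pc pf pn pu pr _ cfg v
  (fun p x => Ev x p) (@lex _ _ k t) (fun x => connect Ev x v)
  (fun x => #|{: k.-tuple (node t)}| - #|connect Ev x|) (pred1 u).
- exact: connect0.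
- by move=> p x pv xp; exact: (connect_trans (connect1 xp) pv).
- move=> p x pv xp.
  suff lt_reach : #|connect Ev p| < #|connect Ev x|.
    exact: (ltn_sub2l (leq_trans lt_reach (max_card _)) lt_reach).
  apply: proper_card; apply/properP; split.
    by apply/subsetP => y; exact: (connect_trans (connect1 xp)).
  exists x; first exact: connect0.
  exact: (acyclic _ _ (connect_trans (connect1 xp) pv) xp).
- by move=> p x _ xp; apply: contraTneq xp => ->.
- exact: lex_irr.
- exact: lex_trans.
- by move=> p x y _ _ _; apply: lex_total.
- by move=> x _; apply: runc.
- by move=> x _; apply: runr.
- move=> x _; have [[y /andP[yx ymin] run]|[nfirst run]] := hpf t e alpha pl x.
    left; exists y => //; split=> // z zx; apply/negP => zy.
    by case/existsP: ymin; exists z; apply/andP.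
  right; split=> // y; apply/negP => yx.
  have [z zx zmin] := ex_minimal (S := fun z => Ev z x)
    (@lex_irr _ _ k t) (@lex_trans _ _ k t) yx.
  have /negP := nfirst z; apply; apply/andP; split=> //.
  by apply/existsP => -[w /andP[wx]]; apply/negP; apply: zmin.
- move=> p x _ xp; have [[y /and3P[xy ltxy ymin] run]|[nnext run]] := hpn t e alpha pl x.
    left; exists y => //; split=> //; first by rewrite -(sibE p x).
    move=> z zp xz; apply/negP => zy; case/existsP: ymin; exists z.
    by rewrite (sibE p x) ?zp ?xz.
  right; split=> // y yp; apply/negP => xy.
  have [|z /andP[zp xz] zmin] := ex_minimal (S := fun z => Ev z p && lex x z) (x := y)
    (@lex_irr _ _ k t) (@lex_trans _ _ k t); first by rewrite yp.
  have /negP := nnext z; apply; rewrite /next (sibE p x) // zp xz /=.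
  apply/existsP => -[w]; rewrite (sibE p x) // => /and3P[wp xw].
  by apply/negP; apply: zmin; rewrite wp.
- move=> p x _ xp; have [[y xy run]|[nup _]] := hpu t e alpha pl x.
    by rewrite (funE _ _ _ xp xy).
  by have := nup p; rewrite [E _ _ _ _]xp.
have reachE : (y == u) = connect Rv u v.
  rewrite [LHS]Fy; transitivity (connect Ev u v).
    apply/existsP/idP => [[x /andP[vx /eqP xu]]|uv].
      by move: vx; rewrite xu; have := connect_rev Ev v u => /= ->.
    by exists u; rewrite /= eqxx andbT; have := connect_rev Ev v u => /= ->.
  apply/idP/idP.
    by apply: connect_sub => x z /andP[xz _]; apply: connect1.
  move=> /connectP[s us Es]; elim: s u us Es {Fy Fr run runc} => [|z s IH] x /=.
    by move=> _ ->.
  case/andP=> xz zs /(IH _ zs) zv.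
  have [->//|nxv] := eqVneq x v.
  by apply: (connect_trans _ zv); apply: connect1; apply/andP.
rewrite -[X in runs _ _ X _]/(connect Rv u v) -reachE.
apply: (runs_cond run); rewrite /= -(names_pebs N d (tnth y)).
by case: (y == u); apply: (runs_andthen (runs_retrieve_all i0 _ _ _)); apply: runs_answer.
Qed.

End CheckableDTC.

Theorem formula_automaton (Sigma : finType) (rank : Sigma -> nat) k (i0 : 'I_k)
    (phi : formula Sigma k) : is_FO_DTC rank phi ->
  exists A : ptwa Sigma k,
    deterministic A /\ forall t : tree rank, models t phi <-> accepts A t.
Proof.
move=> /(sat_class (checkable_class rank i0) (@checkable_dtc _ rank k i0))[m hphi].
pose x0 : 'I_m.+2 := inord 0.
have [|p hp] := hphi m.+1 1 (fun=> x0) => //.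
pose finish b := andthen (perform (Retrieve x0)) (answer Sigma _ i0 b).
pose P := andthen (perform (Drop i0 x0)) (cond p (finish true) (finish false)).
exists (prog_automaton P); split=> [|t]; first exact: prog_automaton_det.
suff run : runs P (top k t, [::]) (sat (fun=> root t) phi) (top k t, [::]).
  by have [acc sat] := prog_automatonP run; split.
have pl : placed 1 (fun=> x0) (fun _ : nat => root t) [:: (x0, root t)].
  split=> //= [x|_]; rewrite inE // => /eqP->.
  by rewrite inordK.
apply: (runs_andthen (c' := (top k t, [:: (x0, root t)])) (b := true)).
  by rewrite -(tnth_top t i0); apply: runs_perform; apply: ExecDrop.
apply: (runs_cond (hp _ _ _ pl)).
by case: (sat _ _); apply: (runs_andthen (runs_retrieve _ _ _ _)); apply: runs_answer.
Qed.

Theorem theorem5p3 (Sigma : finType) (rank : Sigma -> nat) (k : nat) (hk : 0 < k)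
    (L : tree rank -> Prop) :
  (exists A : ptwa Sigma k,
      deterministic A /\ forall t : tree rank, L t <-> accepts A t)
  <->
  (exists phi : formula Sigma k,
      [/\ closed_formula phi, is_FO_DTC rank phi
        & forall t : tree rank, L t <-> models t phi]).
Proof.
split=> [[A [Adet LA]]|[phi [_ dtc Lphi]]].
  have [phi [closed dtc Aphi]] := automaton_formula rank Adet.
  by exists phi; split=> // t; exact: (iff_trans (LA t) (Aphi t)).
have [A [Adet Aphi]] := formula_automaton (Ordinal hk) dtc.
by exists A; split=> // t; exact: (iff_trans (Lphi t) (Aphi t)).
Qed.
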